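(* Let $(M,g)=(I\times_fF,\,-dt^2+f(t)^2g_F)$ be a generalized Robertson–Walker spacetime with $I=(a,\infty)$. If there exist $t_1$ and a constant $C$ such that $f(t)\ge C>0$ for all $t\ge t_1$, then all future-directed timelike geodesics are complete.
   Context: A generalized Robertson–Walker spacetime is a warped product $M=I\times_fF$, where $I\subset\mathbb{R}$ is an interval, $(F,g_F)$ is a Riemannian manifold, $f>0$ is a smooth function on $I$, and $g=-dt^2+f(t)^2g_F$. Completeness of a future-directed geodesic means future completeness (the geodesic extends to arbitrarily large affine parameter values), as in the title ''Future Timelike Completeness'' of the statement.
   Formalization: The fiber (F, g_F) is assumed geodesically complete, which the statement omits; without it the claim is false (f = 1, F = (0,1): a strip of Minkowski space), and it fails for every incomplete fiber. *)

(* Defs.v *)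
From HB Require Import structures.
From mathcomp Require Import all_boot all_order all_algebra.
From mathcomp Require Import all_classical all_reals all_analysis.
Import Order.TTheory GRing.Theory Num.Theory.
Import numFieldNormedType.Exports.

Set Implicit Arguments.
Unset Strict Implicit.
Unset Printing Implicit Defensive.

Local Open Scope classical_set_scope.
Local Open Scope ring_scope.

(* The end points are extended reals, so rays and the whole line are included. *)
Definition open_itv (R : realType) (a b : \bar R) : set R :=
  [set s | (a < s%:E)%E /\ (s%:E < b)%E].

(* Meant for open U.  On finite-dimensional spaces this is C^k in the usual
   sense: h is C^(k+1) iff it is differentiable and all of its directional
   derivatives are C^k. *)
Fixpoint Ck_on (R : realType) (V W : normedModType R) (k : nat) (U : set V)
    (h : V -> W) {struct k} : Prop :=
  if k is k'.+1 then
    (forall x, U x -> differentiable h x) /\ (forall v, Ck_on k' U ('D_v h))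
  else forall x, U x -> {for x, continuous h}.

Definition smooth_on (R : realType) (V W : normedModType R) (U : set V)
    (h : V -> W) : Prop :=
  forall k, Ck_on k U h.

(* Raw data of an n-manifold with an atlas and a metric tensor: [chart i] is
   meaningful on [chart_dom i], and [gram i y] is the matrix of components
   g(d_k, d_l) of the metric in the chart i, at the point with coordinates y
   in the image of that chart.  The axioms are stated separately below. *)
Record metric_atlas (R : realType) (n : nat) := MetricAtlas {
  carrier :> topologicalType;
  chart_index : Type;
  chart_dom : chart_index -> set carrier;
  chart : chart_index -> carrier -> 'rV[R]_n;
  gram : chart_index -> 'rV[R]_n -> 'M[R]_n
}.

Arguments chart_index {R n} m.
Arguments chart_dom {R n} m _ _.
Arguments chart {R n} m _ _.
Arguments gram {R n} m _ _.

(* The change of coordinates (chart j) o (chart i)^-1, extended by 0 outside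
   of the image of the overlap under chart i. *)
Definition transition (R : realType) (n : nat) (M : metric_atlas R n)
    (i j : chart_index M) (y : 'rV[R]_n) : 'rV[R]_n :=
  xget 0 [set z | exists p, [/\ chart_dom M i p, chart_dom M j p,
                                chart M i p = y & chart M j p = z]].

Record smooth_manifold (R : realType) (n : nat) (M : metric_atlas R n) :
    Prop := SmoothManifold {
  _ : hausdorff_space M;
  _ : @second_countable M;
  _ : forall p : M, exists i, chart_dom M i p;
  _ : forall i, open (chart_dom M i);
  _ : forall i, set_inj (chart_dom M i) (chart M i);
  _ : forall i p, chart_dom M i p -> {for p, continuous (chart M i)};
  _ : forall i (U : set M), open U -> U `<=` chart_dom M i ->
        open (chart M i @` U);
  _ : forall i j, smooth_on (chart M i @` (chart_dom M i `&` chart_dom M j))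
                            (@transition R n M i j)
}.

(* Vectors are rows and [jacobian h y] acts on them from the right, so the last
   clause says g(u, v) = g(d tau u, d tau v) for the transition map tau. *)
Record riemannian_manifold (R : realType) (n : nat) (M : metric_atlas R n) :
    Prop := RiemannianManifold {
  _ : smooth_manifold M;
  _ : forall i, smooth_on (chart M i @` chart_dom M i) (gram M i);
  _ : forall i p, chart_dom M i p ->
        (gram M i (chart M i p))^T = gram M i (chart M i p);
  _ : forall i p (v : 'rV[R]_n), chart_dom M i p -> v != 0 ->
        0 < (v *m gram M i (chart M i p) *m v^T) 0 0;
  _ : forall i j p, chart_dom M i p -> chart_dom M j p ->
        let J := jacobian (@transition R n M i j) (chart M i p) in
        gram M i (chart M i p) = J *m gram M j (chart M j p) *m J^T
}.

(* Gamma^k_ij = 1/2 g^kl (d_i g_jl + d_j g_il - d_l g_ij) *)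
Definition christoffel (R : realType) (n : nat) (G : 'rV[R]_n -> 'M[R]_n)
    (y : 'rV[R]_n) (k i j : 'I_n) : R :=
  2^-1 * \sum_(l < n) invmx (G y) k l *
    ('D_(delta_mx 0 i) (fun z => G z j l) y
     + 'D_(delta_mx 0 j) (fun z => G z i l) y
     - 'D_(delta_mx 0 l) (fun z => G z i j) y).

(* Only the values of c at parameters with c s in the domain of the chart
   matter. *)
Definition coord_curve (R : realType) (n : nat) (M : metric_atlas R n)
    (i : chart_index M) (c : R -> M) : R -> 'rV[R]_n :=
  fun s => chart M i (c s).

(* A geodesic with domain ]alpha, beta[: a continuous curve whose coordinate
   expressions are twice differentiable and solve
   x''^k + Gamma^k_ij x'^i x'^j = 0; such a curve is automatically smooth.
   The values of c outside ]alpha, beta[ are irrelevant. *)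
Definition geodesic (R : realType) (n : nat) (M : metric_atlas R n)
    (alpha beta : \bar R) (c : R -> M) : Prop :=
  (alpha < beta)%E /\
  forall s, open_itv alpha beta s ->
    {for s, continuous c} /\
    forall i, chart_dom M i (c s) ->
      let x := coord_curve i c in
      [/\ derivable x s 1, derivable (derive1 x) s 1
        & forall k, derive1 (derive1 x) s 0 k
            + \sum_(p < n) \sum_(q < n)
                christoffel (gram M i) (x s) k p q
                * derive1 x s 0 p * derive1 x s 0 q = 0].

Definition geodesically_complete (R : realType) (n : nat)
    (M : metric_atlas R n) : Prop :=
  forall (alpha beta : \bar R) (c : R -> M), geodesic alpha beta c ->
    exists c' : R -> M, geodesic -oo%E +oo%E c' /\
      forall s, open_itv alpha beta s -> c' s = c s.

Definition future_complete (R : realType) (n : nat) (M : metric_atlas R n)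
    (alpha beta : \bar R) (c : R -> M) : Prop :=
  exists c' : R -> M, geodesic alpha +oo%E c' /\
    forall s, open_itv alpha beta s -> c' s = c s.

Definition timelike (R : realType) (n : nat) (M : metric_atlas R n)
    (alpha beta : \bar R) (c : R -> M) : Prop :=
  forall s i, open_itv alpha beta s -> chart_dom M i (c s) ->
    let v := derive1 (coord_curve i c) s in
    (v *m gram M i (chart M i (c s)) *m v^T) 0 0 < 0.

(* The warped product (I x F, -dt^2 + f(t)^2 g_F), with the product charts
   (t, q) |-> (t, chart i q).  Only the values of f on I matter. *)
Definition grw (R : realType) (n : nat) (I : set R) (f : R -> R)
    (F : metric_atlas R n) : metric_atlas R (1 + n) :=
  @MetricAtlas R (1 + n) (set_type I * F)%type (chart_index F)
    (fun i => [set p | chart_dom F i p.2])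
    (fun i p => row_mx (set_val p.1)%:M (chart F i p.2))
    (fun i y => block_mx (-1)%:M 0
                         0 (f (lsubmx y 0 0) ^+ 2 *: gram F i (rsubmx y))).

(* The time orientation is the one of the vector field d_t, whose components in
   every product chart are (1, 0, .., 0): a causal vector v is future-directed
   iff g(v, d_t) < 0. *)
Definition future_directed (R : realType) (n : nat) (I : set R) (f : R -> R)
    (F : metric_atlas R n) (alpha beta : \bar R) (c : R -> grw I f F) : Prop :=
  forall s i, open_itv alpha beta s -> chart_dom (grw I f F) i (c s) ->
    let v := derive1 (coord_curve i c) s in
    let dt : 'rV[R]_(1 + n) := row_mx 1%:M 0 in
    (v *m gram (grw I f F) i (chart (grw I f F) i (c s)) *m dt^T) 0 0 < 0.

(* Main.v *)
Require Import Defs.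
From HB Require Import structures.
From mathcomp Require Import all_boot all_order all_algebra.
From mathcomp Require Import all_classical all_reals all_analysis.
From mathcomp Require Import ring lra.
Import Order.TTheory GRing.Theory Num.Theory.
Import numFieldNormedType.Exports.
Local Open Scope classical_set_scope.
Local Open Scope ring_scope.

Set Implicit Arguments.
Unset Strict Implicit.
Unset Printing Implicit Defensive.

(** Let [(t, q)] be a geodesic of [I x_f F] on [(alpha, beta)].  Its equations are
    [t'' = - f f' g(q', q')] and [nabla_q' q' = - 2 (f'/f) t' q'], where [f] and
    [f'] are taken at [t].  Two quantities are therefore constant along it:
    [K = f(t)^4 g(q', q')] and [E = t'^2 - f(t)^2 g(q', q')]; this is
    [timelike_first_integrals].  [K] is nonnegative because [g] is Riemannian, and
    [E] is positive because the geodesic is timelike, so a future-directed one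
    satisfies the autonomous scalar equation [t' = sqrt(E + K / f(t)^2)].

    Such an equation is solved by quadrature: the solution is the inverse of an
    antiderivative [S] of [1 / sqrt(E + K / f^2)].  Since [f >= C] near infinity,
    the integrand is bounded below there, so that [S] is unbounded and [t]
    continues to a solution [T] for all later parameters
    ([autonomous_extension]).

    The equation of [q] says that [q] is a geodesic up to reparametrization:
    [q = gamma o r] with [r' = 1 / f(t)^2] and [gamma] a geodesic of [F]
    ([fiber_reparam_geodesic]).  The antiderivative [r] of [1 / f(T)^2] exists
    past [beta] because [T] does, and [gamma] extends to the whole line because
    [F] is complete.  The curve [(T, gamma o r)] is again a geodesic of the
    warped product ([grw_geodesic_at_lift]) and coincides with [(t, q)] shortly
    before [beta]; gluing the two gives the extension.  Thus completeness of [F]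
    replaces every appeal to existence theorems for differential equations.

    The geodesic equations of the warped product come from
    [christoffel_form_warped], and the conservation of [K] and [E] from
    [is_derive_sqspeed], the compatibility of the Levi-Civita connection with
    the metric. *)

(** * Inverting and integrating functions of one variable *)

Section OneVariable.
Context {R : realType}.
Implicit Types (f g h S T t phi : R -> R) (a b x y s u v : R).

Lemma is_derive_continuous {V : normedModType R} (g : R -> V) x dg :
  is_derive x 1 g dg -> {for x, continuous g}.
Proof.
by move=> [dgx _]; exact/differentiable_continuous/derivable1_diffP.
Qed.

Lemma is_derive_continuous_segment g dg a b :
  (forall x, a <= x <= b -> is_derive x 1 g (dg x)) ->
  {within `[a, b], continuous g}.
Proof.
move=> gd; apply: derivable_within_continuous => x; rewrite in_itv /= => xab.
by have [] := gd _ xab.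
Qed.

Lemma mean_value g dg a b : a < b ->
  (forall x, a <= x <= b -> is_derive x 1 g (dg x)) ->
  exists2 c, a < c < b & g b - g a = dg c * (b - a).
Proof.
move=> ab gd.
have gd' x : x \in `]a, b[ -> is_derive x 1 g (dg x).
  by rewrite in_itv /= => /andP[ax xb]; apply: gd; rewrite !ltW.
have [c cab ->] := MVT ab gd' (is_derive_continuous_segment gd).
by exists c => //; move: cab; rewrite in_itv.
Qed.

Lemma open_itv_between (a b : \bar R) x y z :
  open_itv a b x -> open_itv a b y -> x <= z <= y -> open_itv a b z.
Proof.
move=> [ax _] [_ yb] /andP[xz zy]; split.
  by apply: lt_le_trans ax _; rewrite lee_fin.
by apply: le_lt_trans yb; rewrite lee_fin.
Qed.

Lemma derive0_constant (a b : \bar R) g :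
  (forall s, open_itv a b s -> is_derive s 1 g 0) ->
  forall x y, open_itv a b x -> open_itv a b y -> g x = g y.
Proof.
move=> gd.
have main x y : x < y -> open_itv a b x -> open_itv a b y -> g x = g y.
  move=> xy xI yI; have [|c _] := @mean_value g (fun=> 0) x y xy.
    by move=> z xzy; apply: gd; exact: open_itv_between xzy.
  by rewrite mul0r => /eqP; rewrite subr_eq0 => /eqP.
move=> x y xI yI; case: (ltgtP x y) => [xy|yx|-> //]; first exact: main.
by apply/esym/main.
Qed.

(** The integral from the base point [a] is differentiable only to the right of
    [a], whence the different domains of hypothesis and conclusion. *)
Lemma exists_antiderivative a g :
  (forall x, a <= x -> {for x, continuous g}) ->
  exists G, forall x, a < x -> is_derive x 1 G (g x).
Proof.
move=> gc.
exists (fun x => (\int[@lebesgue_measure R]_(t in [set` `[a, x]]) (g t))%R).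
move=> x ax.
have int_g : (@lebesgue_measure R).-integrable `[a, (x + 1)] (EFin \o g).
  apply: continuous_compact_integrable; first exact: segment_compact.
  apply: continuous_in_subspaceT => y; rewrite inE /= in_itv /= => /andP[ay _].
  exact: gc.
have x_lt : x < x + 1 by rewrite ltrDl.
have [dG G'E] := continuous_FTC1_closed x_lt int_g ax (gc _ (ltW ax)).
by rewrite derive1E in G'E; exact: DeriveDef dG G'E.
Qed.

Section Increasing.
Variables (b : R) (S h : R -> R).
Hypothesis S_deriv : forall x, b < x -> is_derive x 1 S (h x).
Hypothesis h_gt0 : forall x, b < x -> 0 < h x.

Lemma derive_gt0_lt x y : b < x -> x < y -> S x < S y.
Proof.
move=> bx xy; have [|c /andP[xc cy] SE] := @mean_value S h x y xy.
  by move=> z /andP[xz _]; apply: S_deriv; exact: lt_le_trans xz.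
by rewrite -subr_gt0 SE mulr_gt0 ?subr_gt0// h_gt0// (lt_trans bx).
Qed.

Lemma derive_gt0_inj x y : b < x -> b < y -> S x = S y -> x = y.
Proof.
move=> bx bY SE; case: (ltgtP x y) => // xy.
  by have := derive_gt0_lt bx xy; rewrite SE ltxx.
by have := derive_gt0_lt bY xy; rewrite SE ltxx.
Qed.

Lemma derive_gt0_IVT x y u : b < x -> x < y -> S x < u < S y ->
  exists2 z, x < z < y & S z = u.
Proof.
move=> bx xy /andP[xu uy].
have Sxy := derive_gt0_lt bx xy.
have [||z] := @IVT R S x y u (ltW xy).
- apply: (@is_derive_continuous_segment _ h) => z /andP[xz _].
  by apply: S_deriv; exact: lt_le_trans xz.
- by rewrite (min_idPl _) ?(max_idPr _) ?ltW.
rewrite in_itv /= => /andP[xz zy] Sz; exists z => //.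
rewrite !lt_neqAle xz zy !andbT; apply/andP; split.
- by apply: contraTneq xu => ->; rewrite Sz ltxx.
- by apply: contraTneq uy => <-; rewrite Sz ltxx.
Qed.

Lemma exists_inverse :
  exists T, forall x, b < x ->
    T (S x) = x /\ is_derive (S x) 1 T (h x)^-1.
Proof.
pose T u := xget b [set x | b < x /\ S x = u].
have TK x : b < x -> T (S x) = x.
  move=> bx; rewrite /T; case: xgetP => [y _ [bY]|/(_ x)]; last by case.
  by move/(derive_gt0_inj bY bx).
exists T => x bx; split; first exact: TK.
apply: is_derive_inverse; last by rewrite gt_eqF// h_gt0.
- by near=> y; apply: TK; near: y; exact: lt_nbhsr.
- near=> y; apply: is_derive_continuous (S_deriv _).
  by near: y; exact: lt_nbhsr.
- exact: S_deriv.
Unshelve. all: by end_near. Qed.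

End Increasing.

(** By the mean value theorem [S] grows at least linearly with slope [m] once
    past [a]. *)
Lemma derive_bound_unbounded b m a S h :
  0 < m -> (forall x, b < x -> is_derive x 1 S (h x)) ->
  (forall x, b < x -> a <= x -> m <= h x) ->
  forall u, exists x, [/\ b < x, a <= x & u < S x].
Proof.
move=> m_gt0 Sd hm u.
pose x0 := Num.max a (b + 1).
have bx0 : b < x0 by rewrite /x0 lt_max ltrDl ltr01 orbT.
have ax0 : a <= x0 by rewrite /x0 le_max lexx.
pose d := (`|u - S x0| + 1) / m.
have d_gt0 : 0 < d by rewrite divr_gt0// ltr_wpDl.
have lt_x0 : x0 < x0 + d by rewrite ltrDl.
exists (x0 + d); split; first exact: lt_trans lt_x0.
  exact: le_trans ax0 (ltW lt_x0).
have [|c /andP[xc _] SE] := @mean_value S h _ _ lt_x0.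
  by move=> z /andP[xz _]; apply: Sd; exact: lt_le_trans xz.
rewrite -(ltrD2r (- S x0)) SE addrAC subrr add0r.
have : m * d <= h c * d.
  apply: ler_wpM2r; first exact: ltW.
  by apply: hm; [exact: lt_trans xc|exact: le_trans (ltW xc)].
apply: lt_le_trans; rewrite /d mulrC divfK ?gt_eqF//.
by rewrite (le_lt_trans (ler_norm _))// ltrDl.
Qed.

(** Solutions of [t' = phi(t)] with [phi > 0] are, up to a translation of the
    parameter, inverse to an antiderivative [S] of [1 / phi].  The bound
    [phi <= B] makes [S] unbounded, so that the inverse never stops: a solution
    that starts above [b] escapes to infinity only in infinite time. *)
Lemma autonomous_extension b phi B a t s0 s1 :
  (forall x, b <= x -> {for x, continuous phi}) ->
  (forall x, b <= x -> 0 < phi x) ->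
  (forall x, b <= x -> a <= x -> phi x <= B) ->
  s0 < s1 ->
  (forall s, s0 < s < s1 -> b < t s /\ is_derive s 1 t (phi (t s))) ->
  exists T, (forall s, s0 < s < s1 -> T s = t s) /\
    (forall s, s0 < s -> b < T s /\ is_derive s 1 T (phi (T s))).
Proof.
move=> phic phi_gt0 phiB s01 tP.
have [|S Sd] := @exists_antiderivative b (fun x => (phi x)^-1).
  by move=> x bx; apply: continuousV; [rewrite gt_eqF// phi_gt0|exact: phic].
have iphi_gt0 x : b < x -> 0 < (phi x)^-1.
  by move=> bx; rewrite invr_gt0 phi_gt0// ltW.
have [T0 T0P] := exists_inverse Sd iphi_gt0.
(* S o t has derivative 1, so it is a translation. *)
pose sm := (s0 + s1) / 2.
have smP : s0 < sm < s1 by rewrite !midf_lt.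
pose k := S (t sm) - sm.
have StE s : s0 < s < s1 -> S (t s) = s + k.
  have Std z : s0 < z < s1 -> is_derive z 1 (fun z => S (t z) - z) 0.
    move=> zP; have [bt td] := tP _ zP.
    have Sd' := Sd _ bt.
    have H := @is_derive1_comp _ S t z _ _ Sd' td.
    have H2 := is_deriveB H (is_derive_id z (1 : R)).
    apply: is_derive_eq H2 _.
    by rewrite mulVf ?subrr// gt_eqF// phi_gt0// ltW.
  have oitvE z : s0 < z < s1 -> open_itv s0%:E s1%:E z.
    by rewrite /open_itv /= !lte_fin => /andP.
  move=> sP; suff E : S (t s) - s = k by rewrite -E addrC subrK.
  apply: (@derive0_constant s0%:E s1%:E (fun z => S (t z) - z)); last 2 first.
  - exact: oitvE.
  - exact: oitvE.
  by move=> z; rewrite /open_itv /= !lte_fin => /andP; exact: Std.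
(* For s >= s1 the value s + k lies between S (t sm) and a value S y, where y is
   provided by the unboundedness of S. *)
have reach s : s0 < s -> exists2 x, b < x & S x = s + k.
  move=> s0s; case: (ltP s s1) => ss1.
    have sP : s0 < s < s1 by apply/andP.
    by exists (t s); [case: (tP _ sP)|exact: StE].
  have [bt _] := tP _ smP.
  have phi1 : 0 < phi (Num.max b a) by apply: phi_gt0; rewrite le_max lexx.
  have B_gt0 : 0 < B.
    by apply: lt_le_trans phi1 _; apply: phiB; rewrite le_max lexx ?orbT.
  have B'_gt0 : 0 < B^-1 by rewrite invr_gt0.
  have [|y [bY _ uy]] := @derive_bound_unbounded b _ a S _ B'_gt0 Sd _ (s + k).
    by move=> x bx ax; rewrite lef_pV2 ?posrE ?phiB ?phi_gt0// ltW.
  have lt_u : S (t sm) < s + k.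
    by rewrite StE// ltrD2r; apply: lt_le_trans ss1; case/andP: smP.
  have tm_y : t sm < y.
    rewrite ltNge; apply/negP; rewrite le_eqVlt => /predU1P[yE|ytm].
      by move: (lt_trans lt_u uy); rewrite yE ltxx.
    have := derive_gt0_lt Sd iphi_gt0 bY ytm.
    by rewrite ltNge (ltW (lt_trans lt_u uy)).
  have [|z /andP[mz _] Sz] := derive_gt0_IVT Sd iphi_gt0 bt tm_y (u := s + k).
    by rewrite lt_u.
  by exists z => //; exact: lt_trans mz.
exists (fun s => T0 (s + k)); split.
  by move=> s sP; have [bt _] := tP _ sP; rewrite -StE//; case: (T0P _ bt).
move=> s /reach [x bx xE]; rewrite -xE; have [-> dT] := T0P _ bx; split=> //.
rewrite invrK xE in dT.
have dk : is_derive s 1 (fun z => z + k) 1.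
  have H := is_deriveD (is_derive_id s (1 : R)) (is_derive_cst k s 1).
  by apply: is_derive_eq H _; rewrite addr0.
have H := @is_derive1_comp _ T0 (fun z => z + k) s _ _ dT dk.
by apply: is_derive_eq H _; rewrite mulr1.
Qed.

End OneVariable.

Section PointwiseRules.
Context {R : realType}.
Implicit Types (g h : R -> R) (s dg dh : R).

Lemma is_derive_mulr g h s dg dh :
  is_derive s 1 g dg -> is_derive s 1 h dh ->
  is_derive s 1 (fun u => g u * h u) (dg * h s + g s * dh).
Proof.
move=> gd hd; apply: is_derive_eq (is_deriveM gd hd) _.
rewrite -[LHS]/(g s * dh + h s * dg); ring.
Qed.

Lemma is_derive_sqr g s dg :
  is_derive s 1 g dg -> is_derive s 1 (fun u => g u ^+ 2) (2 * g s * dg).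
Proof.
move=> gd; under eq_fun do rewrite expr2.
by apply: is_derive_eq (is_derive_mulr gd gd) _; ring.
Qed.

Lemma is_derive_subr g h s dg dh :
  is_derive s 1 g dg -> is_derive s 1 h dh ->
  is_derive s 1 (fun u => g u - h u) (dg - dh).
Proof. by move=> gd hd; exact: is_deriveB gd hd. Qed.

Lemma is_derive_invr g s dg : g s != 0 -> is_derive s 1 g dg ->
  is_derive s 1 (fun u => (g u)^-1) (- (g s ^+ 2)^-1 * dg).
Proof. by move=> g0 gd; exact: is_deriveV g0 gd. Qed.

Lemma is_derive_compr g h s dg dh :
  is_derive (h s) 1 g dg -> is_derive s 1 h dh ->
  is_derive s 1 (fun u => g (h u)) (dg * dh).
Proof. by move=> gd hd; exact: is_derive1_comp gd hd. Qed.

End PointwiseRules.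

Lemma open_itvP {R : realType} (a b : \bar R) s :
  open_itv a b s -> \forall u \near s, open_itv a b u.
Proof.
move=> [sa sb]; apply: filterI.
  case: a sa => [r| |] // ar; last by near=> u; exact: ltNyr.
  near=> u; rewrite lte_fin; near: u; exact: lt_nbhsr.
case: b sb => [r| |] // rb; last by near=> u; exact: ltry.
near=> u; rewrite lte_fin; near: u; exact: lt_nbhsl.
Unshelve. all: by end_near. Qed.

Lemma open_itv_inhabited {R : realType} (a : \bar R) (b : R) :
  (a < b%:E)%E -> exists s, open_itv a b%:E s.
Proof.
case: a => [a| |] // => [|_].
  by rewrite lte_fin => ab; exists ((a + b) / 2); split; rewrite lte_fin !midf_lt.
by exists (b - 1); split; [exact: ltNyr|rewrite lte_fin gtrDl ltrN10].
Qed.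

(** * Second-order derivatives of curves *)

Section MatrixCurves.
Context {R : realType}.

Lemma derive_lineE {V W : normedModType R} (h : V -> W) x v :
  'D_v h x = 'D_1 (fun k : R => h (k *: v + x)) 0.
Proof.
rewrite /derive; set a := fun k => _; set b := fun k => _.
suff -> : a = b by [].
by apply/funext => k; rewrite /a /b /= addr0 scale0r add0r [_%:A]mulr1.
Qed.

(** The inner function only has to be derivable in the direction [v]: restricting
    it to a line reduces the claim to the composition of differentiable
    functions. *)
Lemma is_derive_comp_diff {U V W : normedModType R} (g : U -> V) (h : V -> W)
    x v dg :
  is_derive x v g dg -> differentiable h (g x) ->
  is_derive x v (h \o g) ('D_dg h (g x)).
Proof.
move=> [dgx <-] dh.
pose l (k : R) := g (k *: v + x).
have l0 : l 0 = g x by rewrite /l scale0r add0r.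
have dl : differentiable l 0.
  by apply/derivable1_diffP; exact: (derivable1P _ _ _).1 dgx.
have dh' : differentiable h (l 0) by rewrite l0.
have dhl : differentiable (h \o l) 0 by exact: differentiable_comp.
apply: DeriveDef; first by apply: (derivable1P _ _ _).2; exact/derivable1_diffP.
rewrite derive_lineE -[fun k : R => _]/(h \o l) deriveE// diff_comp//=.
by rewrite l0 deriveE// (derive_lineE g) (deriveE (1 : R) dl).
Qed.

Lemma is_derive_curve_comp {V : normedModType R} (x : R -> V) (phi : R -> R)
    (u : R) dx dphi :
  is_derive (phi u) 1 x dx -> is_derive u 1 phi dphi ->
  is_derive u 1 (x \o phi) (dphi *: dx).
Proof.
move=> [xd xE] dp.
have dx' : differentiable x (phi u) by exact/derivable1_diffP.
apply: is_derive_eq (is_derive_comp_diff dp dx') _.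
by rewrite deriveE// deriv1E// derive1E xE.
Qed.

Lemma is_derive_mxP {V : normedModType R} m n (M : V -> 'M[R]_(m, n)) x v D :
  is_derive x v M D <-> forall i j, is_derive x v (fun z => M z i j) (D i j).
Proof.
split=> [[Md <-] i j|MD].
  rewrite derive_mx// mxE; apply: derivableP; exact: (derivable_mxP _ _ _).1.
have Md : derivable M x v by apply/derivable_mxP => i j; case: (MD i j).
apply: DeriveDef => //; rewrite derive_mx//; apply/matrixP => i j.
by rewrite mxE; case: (MD i j).
Qed.

Lemma is_derive_mulmx {V : normedModType R} m n p (A : V -> 'M[R]_(m, n))
    (B : V -> 'M[R]_(n, p)) x v dA dB :
  is_derive x v A dA -> is_derive x v B dB ->
  is_derive x v (fun z => A z *m B z) (dA *m B x + A x *m dB).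
Proof.
move=> /is_derive_mxP AD /is_derive_mxP BD; apply/is_derive_mxP => i j.
have -> : (fun z => (A z *m B z) i j) = \sum_k (fun z => A z i k * B z k j).
  by apply/funext => z; rewrite fct_sumE mxE.
have H := is_derive_sum (fun k => is_deriveM (AD i k) (BD k j)).
apply: is_derive_eq H _; rewrite !mxE -big_split /=; apply: eq_bigr => k _.
by rewrite addrC; congr (_ + _); exact: mulrC.
Qed.

Lemma is_derive_trmx {V : normedModType R} m n (A : V -> 'M[R]_(m, n)) x v dA :
  is_derive x v A dA -> is_derive x v (fun z => (A z)^T) dA^T.
Proof.
move=> /is_derive_mxP AD; apply/is_derive_mxP => i j; rewrite mxE.
by under eq_fun do rewrite mxE; exact: AD.
Qed.

Lemma is_derive_scalemx {V : normedModType R} m n (a : V -> R)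
    (A : V -> 'M[R]_(m, n)) s v da dA :
  is_derive s v a da -> is_derive s v A dA ->
  is_derive s v (fun u => a u *: A u) (da *: A s + a s *: dA).
Proof.
move=> aD /is_derive_mxP AD; apply/is_derive_mxP => i j.
have -> : (fun z => (a z *: A z) i j) = a * (fun z => A z i j).
  by apply/funext => z; rewrite mxE.
apply: is_derive_eq (is_deriveM aD (AD i j)) _.
by rewrite !mxE addrC; congr (_ + _); exact: mulrC.
Qed.

Lemma differentiable_mx {V : normedModType R} k l (M : V -> 'M[R]_(k, l)) x :
  (forall i j, differentiable (fun z => M z i j) x) -> differentiable M x.
Proof.
move=> Md.
have -> : M = \sum_i \sum_j (fun z => M z i j *: delta_mx i j).
  apply/funext => z; rewrite {1}[M z]matrix_sum_delta fct_sumE.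
  by apply: eq_bigr => i _; rewrite fct_sumE.
apply: differentiable_sum => i; apply: differentiable_sum => j.
exact: differentiableZl.
Qed.

End MatrixCurves.

Section Jets.
Context {R : realType}.

(** [v] is the derivative of [x] near [s] and [w] is its second derivative at
    [s].  Naming the velocity [v] lets composite and product curves carry an
    explicit formula instead of an iterated [derive1]. *)
Definition jet2 {V : normedModType R} (x v : R -> V) (w : V) (s : R) : Prop :=
  (\forall u \near s, is_derive u (1 : R) x (v u)) /\ is_derive s 1 v w.

Lemma jet2_derive {V : normedModType R} (x v : R -> V) w (s : R) :
  jet2 x v w s -> is_derive s 1 x (v s).
Proof. by case=> /nbhs_singleton. Qed.

Lemma jet2_near_eq {V : normedModType R} (x y v z : R -> V) w (s : R) :
  (\forall u \near s, x u = y u) -> (\forall u \near s, v u = z u) ->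
  jet2 x v w s -> jet2 y z w s.
Proof.
move=> xy vz [xd vd]; split; last exact: near_eq_is_derive vd.
have xy' : \forall u \near s, \forall u' \near u, x u' = y u'.
  by apply/nbhs_interior.
near=> u.
have -> : z u = v u by apply/esym; near: u.
by apply: (near_eq_is_derive (f := x)); near: u.
Unshelve. all: by end_near. Qed.

Lemma derive1P {V : normedModType R} (x : R -> V) (s : R) v :
  is_derive s 1 x v <-> derivable x s 1 /\ derive1 x s = v.
Proof. by rewrite derive1E; split => -[]. Qed.

Lemma jet2P {V : normedModType R} (x v : R -> V) w (s : R) :
  jet2 x v w s <->
  [/\ \forall u \near s, derivable x u (1 : R),
      \forall u \near s, derive1 x u = v u,
      derivable (derive1 x) s 1 & derive1 (derive1 x) s = w].
Proof.
split=> [[xd vd]|[xd xv vd vw]].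
  have xv : \forall u \near s, derive1 x u = v u.
    by apply: filterS xd => u /derive1P[].
  have /derive1P[? ?] : is_derive s 1 (derive1 x) w.
    by apply: near_eq_is_derive vd; apply: filterS xv => u ->.
  by split=> //; apply: filterS xd => u /derive1P[].
split; first by apply: filterS2 xd xv => u ? ?; exact/derive1P.
by apply: near_eq_is_derive xv _; exact/derive1P.
Qed.

Lemma jet2_derive1 {V : normedModType R} (x v : R -> V) w (s : R) :
  jet2 x v w s -> jet2 x (derive1 x) w s /\ derive1 x s = v s.
Proof.
move=> xJ; have /jet2P[_ xv _ _] := xJ; split; last exact: nbhs_singleton xv.
apply: jet2_near_eq xJ; first by near=> u.
by apply: filterS xv => u ->.
Unshelve. all: by end_near. Qed.

Lemma jet2_comp {m n} (x v : R -> 'M[R]_(m, n)) w (phi dphi : R -> R) ddphi (u : R) :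
  jet2 x v w (phi u) -> jet2 phi dphi ddphi u ->
  jet2 (x \o phi) (fun z => dphi z *: v (phi z))
       (ddphi *: v (phi u) + dphi u ^+ 2 *: w) u.
Proof.
move=> [xd vd] phiJ; have phid := jet2_derive phiJ; case: phiJ => dphiN ddphiE.
split.
  have phic : {for u, continuous phi} by exact: is_derive_continuous phid.
  have xd' : \forall z \near u, is_derive (phi z) 1 x (v (phi z)) := phic _ xd.
  by apply: filterS2 xd' dphiN => z; exact: is_derive_curve_comp.
have H := is_derive_scalemx ddphiE (is_derive_curve_comp vd phid).
by apply: is_derive_eq H _; rewrite scalerA expr2.
Qed.

End Jets.

(** * Christoffel symbols as a quadratic form *)
Section LeviCivita.
Context {R : realType} {n : nat}.
Variables (G : 'rV[R]_n -> 'M[R]_n) (y : 'rV[R]_n).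
Hypothesis G_diff : differentiable G y.

Definition christoffel_form (v : 'rV[R]_n) : 'rV[R]_n :=
  \row_k \sum_(p < n) \sum_(q < n) christoffel G y k p q * v 0 p * v 0 q.

(** The Christoffel form with its index lowered by the metric.  It does not
    involve the inverse Gram matrix, so that it can be computed block by block
    for a warped metric. *)
Definition lower_form (v : 'rV[R]_n) : 'rV[R]_n :=
  v *m 'D_v G y
  - 2^-1 *: \row_l (v *m 'D_(delta_mx 0 l) G y *m v^T) 0 0.

Lemma christoffel_formZ (a : R) v :
  christoffel_form (a *: v) = a ^+ 2 *: christoffel_form v.
Proof.
apply/rowP => k; rewrite !mxE mulr_sumr; apply: eq_bigr => p _.
rewrite mulr_sumr; apply: eq_bigr => q _; rewrite !mxE.
by move: (christoffel _ _ _ _ _) => c; ring.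
Qed.

Lemma derive_gramE v : 'D_v G y = \sum_p v 0 p *: 'D_(delta_mx 0 p) G y.
Proof.
rewrite deriveE// {1}(row_sum_delta v) linear_sum; apply: eq_bigr => p _.
by rewrite linearZ deriveE.
Qed.

Lemma derive_gram_entry v i j : 'D_v (fun z => G z i j) y = ('D_v G y) i j.
Proof. by rewrite derive_mx ?mxE//; exact: diff_derivable. Qed.

Lemma christoffel_form_lower v : (G y)^T = G y -> G y \in unitmx ->
  christoffel_form v *m G y = lower_form v.
Proof.
move=> Gsym Gunit.
suff -> : christoffel_form v = lower_form v *m invmx (G y).
  by rewrite mulmxKV.
have isym : (invmx (G y))^T = invmx (G y) by rewrite trmx_inv Gsym.
apply/rowP => k; rewrite !mxE.
pose D p := 'D_(delta_mx 0 p) G y.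
have lowE l : lower_form v 0 l =
    \sum_p \sum_q 2^-1 * (D p q l + D q p l - D l p q) * v 0 p * v 0 q.
  have E1 : (v *m 'D_v G y) 0 l = \sum_p \sum_q D p q l * v 0 p * v 0 q.
    rewrite mxE exchange_big /=; apply: eq_bigr => q _.
    rewrite derive_gramE summxE mulr_sumr; apply: eq_bigr => p _.
    by rewrite mxE -/(D p); move: (D p q l) => d; ring.
  have E2 : (v *m 'D_v G y) 0 l = \sum_p \sum_q D q p l * v 0 p * v 0 q.
    rewrite E1 exchange_big /=; apply: eq_bigr => q _; apply: eq_bigr => p _.
    by rewrite mulrAC.
  have E3 : (v *m D l *m v^T) 0 0 = \sum_p \sum_q D l p q * v 0 p * v 0 q.
    rewrite mxE exchange_big /=; apply: eq_bigr => q _.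
    rewrite !mxE mulr_suml; apply: eq_bigr => p _.
    by congr (_ * _); rewrite mulrC.
  have -> : lower_form v 0 l =
      (v *m 'D_v G y) 0 l - 2^-1 * (v *m D l *m v^T) 0 0.
    rewrite [LHS]mxE; congr (_ + _); rewrite mxE; congr (- _).
    by rewrite mxE; congr (_ * _); rewrite mxE.
  have half (z : R) : z = 2^-1 * (z + z) by field.
  have E12 : (v *m 'D_v G y) 0 l =
     2^-1 * (\sum_p \sum_q D p q l * v 0 p * v 0 q +
             \sum_p \sum_q D q p l * v 0 p * v 0 q).
    by rewrite -E1 -E2; exact: half.
  rewrite E12 E3 -mulrBr -big_split /= -sumrB mulr_sumr; apply: eq_bigr => p _.
  rewrite -big_split /= -sumrB mulr_sumr; apply: eq_bigr => q _.
  ring.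
under [RHS]eq_bigr do rewrite lowE mulr_suml.
rewrite [RHS]exchange_big /=; apply: eq_bigr => p _.
under [RHS]eq_bigr do rewrite mulr_suml.
rewrite [RHS]exchange_big /=; apply: eq_bigr => q _.
rewrite /christoffel mulr_sumr !mulr_suml; apply: eq_bigr => l _.
have -> : invmx (G y) l k = invmx (G y) k l by rewrite -[in LHS]isym mxE.
rewrite !derive_gram_entry -/(D p) -/(D q) -/(D l); ring.
Qed.

(** In the derivative of [v G v^T] along a geodesic, each of the two acceleration
    terms contributes minus one half of [v (D_v G) v^T], which cancels the
    derivative of [G]: the Levi-Civita connection is compatible with the
    metric. *)
Lemma lower_form_mul v : lower_form v *m v^T = 2^-1 *: (v *m 'D_v G y *m v^T).
Proof.
rewrite mulmxBl -scalemxAl.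
have -> : (\row_l (v *m 'D_(delta_mx 0 l) G y *m v^T) 0 0) *m v^T
    = v *m 'D_v G y *m v^T.
  apply/matrixP => i j; rewrite !ord1 [LHS]mxE derive_gramE mulmx_sumr.
  rewrite mulmx_suml summxE; apply: eq_bigr => l _.
  rewrite -scalemxAr -scalemxAl [RHS]mxE [LHS]mulrC.
  by congr (_ * _); rewrite mxE.
by rewrite -[X in X - _]scale1r -scalerBl; congr (_ *: _); field.
Qed.

End LeviCivita.

(** The chain rule gives [(x o phi)'' = phi'' x' + phi'^2 x''], and the
    Christoffel form is quadratic.  Hence being a geodesic up to
    reparametrization, i.e. having an acceleration proportional to the velocity,
    is stable under reparametrization. *)
Lemma christoffel_reparam {R : realType} {n} (G : 'rV[R]_n -> 'M[R]_n)
    (x v : R -> 'rV[R]_n) w (phi dphi : R -> R) ddphi u (lam : R) :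
  jet2 x v w (phi u) -> jet2 phi dphi ddphi u ->
  w + christoffel_form G (x (phi u)) (v (phi u)) = lam *: v (phi u) ->
  exists w', jet2 (x \o phi) (fun z => dphi z *: v (phi z)) w' u /\
    w' + christoffel_form G (x (phi u)) (dphi u *: v (phi u)) =
      (ddphi + dphi u ^+ 2 * lam) *: v (phi u).
Proof.
move=> xJ phiJ acc; eexists; split; first exact: jet2_comp xJ phiJ.
by rewrite christoffel_formZ -addrA -scalerDr acc scalerA scalerDl.
Qed.

Lemma posdef_unitmx {R : realType} n (A : 'M[R]_n) :
  (forall v : 'rV_n, v != 0 -> 0 < (v *m A *m v^T) 0 0) -> A \in unitmx.
Proof.
move=> Apos; rewrite -row_free_unit; apply: inj_row_free => v vA0.
by apply/eqP; apply: contraT => /Apos; rewrite vA0 mul0mx mxE ltxx.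
Qed.

(** The logarithmic derivative of the squared speed is [2 lam]: the contributions
    of the derivative of [G] are cancelled by [lower_form_mul]. *)
Lemma is_derive_sqnorm {R : realType} n (G : 'rV[R]_n -> 'M[R]_n) x v w
    (lam s : R) :
  differentiable G (x s) -> (G (x s))^T = G (x s) -> G (x s) \in unitmx ->
  jet2 x v w s -> w + christoffel_form G (x s) (v s) = lam *: v s ->
  is_derive s 1 (fun u => (v u *m G (x u) *m (v u)^T) 0 0)
    (2 * lam * (v s *m G (x s) *m (v s)^T) 0 0).
Proof.
move=> Gd Gsym Gunit xJ acc.
have xd := jet2_derive xJ; case: xJ => _ vd.
have Gxd := is_derive_comp_diff xd Gd.
have H := is_derive_mulmx (is_derive_mulmx vd Gxd) (is_derive_trmx vd).
apply: is_derive_eq ((is_derive_mxP _ _ _ _).1 H 0 0) _.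
set D := 'D_(v s) G (x s).
have wG : w *m G (x s) = lam *: (v s *m G (x s)) - lower_form G (x s) (v s).
  have -> : w = lam *: v s - christoffel_form G (x s) (v s) by rewrite -acc addrK.
  by rewrite mulmxBl -scalemxAl christoffel_form_lower.
have tr1 (B : 'M[R]_1) : B = B^T by apply/matrixP => i j; rewrite mxE !ord1.
have vGw : v s *m G (x s) *m w^T = w *m G (x s) *m (v s)^T.
  by rewrite [LHS]tr1 !trmx_mul trmxK Gsym mulmxA.
rewrite /= vGw mulmxDl wG mulmxBl -scalemxAl lower_form_mul// -/D.
move: (v s *m G (x s) *m (v s)^T) (v s *m D *m (v s)^T) => a b.
by rewrite !mxE; field.
Qed.

(** * Christoffel symbols of a warped product *)

Section Warped.
Context {R : realType} {n : nat}.
Variables (f : R -> R) (G : 'rV[R]_n -> 'M[R]_n).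

(** With [G := gram F i] this is convertible to [gram (grw I f F) i]; isolating it
    turns the computation of the Christoffel symbols into matrix algebra. *)
Definition warped_gram (y : 'rV[R]_(1 + n)) : 'M[R]_(1 + n) :=
  block_mx (-1)%:M 0 0 (f (lsubmx y 0 0) ^+ 2 *: G (rsubmx y)).

Variables (t df : R) (y : 'rV[R]_n).
Hypothesis f_deriv : is_derive t 1 f df.
Hypothesis f_neq0 : f t != 0.
Hypothesis G_diff : differentiable G y.
Hypothesis G_sym : (G y)^T = G y.
Hypothesis G_unit : G y \in unitmx.

Let p : 'rV[R]_(1 + n) := row_mx t%:M y.

Let lp : lsubmx p 0 0 = t. Proof. by rewrite row_mxKl mxE. Qed.
Let rp : rsubmx p = y. Proof. exact: row_mxKr. Qed.

Lemma differentiable_warped_gram : differentiable warped_gram p.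
Proof.
have fd : differentiable f (lsubmx p 0 0).
  by rewrite lp; case: f_deriv => ? _; exact/derivable1_diffP.
have Gd : differentiable G (rsubmx p) by rewrite rp.
have fld : differentiable (fun z : 'rV[R]_(1 + n) => f (lsubmx z 0 0)) p.
  apply: (@differentiable_comp _ _ _ _
    (fun z : 'rV[R]_(1 + n) => lsubmx z 0 0) f) => //.
  apply: (@differentiable_comp _ _ _ _ (@lsubmx R 1 1 n) (fun z : 'rV[R]_1 => z 0 0)).
    exact: differentiable_lsubmx.
  exact: differentiable_coord.
have Grd : differentiable (fun z : 'rV[R]_(1 + n) => G (rsubmx z)) p.
  apply: (@differentiable_comp _ _ _ _ (@rsubmx R 1 1 n) G) => //.
  exact: differentiable_rsubmx.
apply: differentiable_mx => i j; rewrite /warped_gram.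
have cstd (a : R) : differentiable (fun _ : 'rV[R]_(1 + n) => a) p.
  exact: differentiable_cst.
case: (split_ordP i) => i' ->; case: (split_ordP j) => j' ->.
- by under eq_fun do rewrite block_mxEul; exact: cstd.
- by under eq_fun do rewrite block_mxEur mxE; exact: cstd.
- by under eq_fun do rewrite block_mxEdl mxE; exact: cstd.
under eq_fun do rewrite block_mxEdr mxE.
have -> : (fun z : 'rV[R]_(1 + n) =>
      f (lsubmx z 0 0) ^+ 2 * G (rsubmx z) i' j') =
    (fun z => f (lsubmx z 0 0)) * (fun z => f (lsubmx z 0 0)) *
    (fun z => G (rsubmx z) i' j').
  by apply/funext => z; rewrite expr2.
apply: differentiableM; first exact: differentiableM.
apply: (@differentiable_comp _ _ _ _ (fun z : 'rV[R]_(1 + n) => G (rsubmx z))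
  (fun B : 'M[R]_n => B i' j')) => //.
exact: differentiable_coord.
Qed.

(** The product rule for [f^2 G]; the blocks of the time direction are
    constant. *)
Lemma derive_warped_gram (a : R) (w : 'rV[R]_n) :
  'D_(row_mx a%:M w) warped_gram p =
  block_mx 0 0 0 ((2 * f t * df * a) *: G y + f t ^+ 2 *: 'D_w G y).
Proof.
apply: derive_val; set v := row_mx _ _; set X := (X in block_mx _ _ _ X).
have idd := (is_derive_mxP _ _ _ _).1 (is_derive_id p v).
have ld : is_derive p v (fun z : 'rV[R]_(1 + n) => lsubmx z 0 0) a.
  under eq_fun do rewrite mxE.
  by apply: is_derive_eq (idd _ _) _; rewrite row_mxEl mxE.
have rd : is_derive p v (@rsubmx R 1 1 n) w.
  apply/is_derive_mxP => i j; under eq_fun do rewrite mxE.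
  by apply: is_derive_eq (idd _ _) _; rewrite row_mxEr ord1.
have fld : is_derive p v (fun z => f (lsubmx z 0 0)) (df * a).
  have fd : differentiable f (lsubmx p 0 0).
    by rewrite lp; case: f_deriv => ? _; exact/derivable1_diffP.
  apply: is_derive_eq (is_derive_comp_diff ld fd) _.
  have fD : derivable f t 1 by case: f_deriv.
  rewrite deriveE// lp deriv1E// derive1E.
  by case: f_deriv => _ ->; exact: mulrC.
have Grd : is_derive p v (fun z => G (rsubmx z)) ('D_w G y).
  have Gd : differentiable G (rsubmx p) by rewrite rp.
  by apply: is_derive_eq (is_derive_comp_diff rd Gd) _; rewrite rp.
have f2d : is_derive p v (fun z => f (lsubmx z 0 0) ^+ 2) (2 * f t * df * a).
  have -> : (fun z : 'rV[R]_(1 + n) => f (lsubmx z 0 0) ^+ 2) =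
      (fun z => f (lsubmx z 0 0)) * (fun z => f (lsubmx z 0 0)).
    by apply/funext => z; rewrite expr2.
  apply: is_derive_eq (is_deriveM fld fld) _; rewrite lp.
  rewrite -[LHS]/(f t * (df * a) + f t * (df * a)); ring.
have /is_derive_mxP Xd : is_derive p v
    (fun z => f (lsubmx z 0 0) ^+ 2 *: G (rsubmx z)) X.
  apply: is_derive_eq (is_derive_scalemx f2d Grd) _.
  by rewrite lp rp.
apply/is_derive_mxP => i j; rewrite /warped_gram.
case: (split_ordP i) => i' ->; case: (split_ordP j) => j' ->.
- under eq_fun do rewrite block_mxEul.
  by rewrite block_mxEul [X in is_derive _ _ _ X]mxE; exact: is_derive_cst.
- under eq_fun do rewrite block_mxEur.
  by rewrite block_mxEur [X in is_derive _ _ _ X]mxE; exact: is_derive_cst.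
- under eq_fun do rewrite block_mxEdl.
  by rewrite block_mxEdl [X in is_derive _ _ _ X]mxE; exact: is_derive_cst.
- by under eq_fun do rewrite block_mxEdr; rewrite block_mxEdr; exact: Xd.
Qed.

Lemma warped_gramE : warped_gram p = block_mx (-1)%:M 0 0 (f t ^+ 2 *: G y).
Proof. by rewrite /warped_gram lp rp. Qed.

Lemma warped_gram_unit : warped_gram p \in unitmx.
Proof.
rewrite warped_gramE unitmxE det_ublock det_scalar1 unitrM -unitmxE.
by rewrite unitmxZ ?G_unit ?unitfE ?expf_neq0// oppr_eq0 oner_eq0.
Qed.

Lemma lower_form_warped (a : R) (w : 'rV[R]_n) :
  lower_form warped_gram p (row_mx a%:M w) =
  row_mx (- (f t * df * (w *m G y *m w^T) 0 0))%:M
    (f t ^+ 2 *: lower_form G y w + (2 * f t * df * a) *: (w *m G y)).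
Proof.
have quad b u : row_mx a%:M w *m 'D_(row_mx b%:M u) warped_gram p
      *m (row_mx a%:M w)^T =
    (2 * f t * df * b) *: (w *m G y *m w^T) + f t ^+ 2 *: (w *m 'D_u G y *m w^T).
  rewrite derive_warped_gram mul_row_block !mulmx0 !add0r tr_row_mx.
  by rewrite mul_row_col mul0mx add0r mulmxDr mulmxDl -!scalemxAr -!scalemxAl.
have dl : delta_mx 0 (lshift n 0) = row_mx 1%:M 0 :> 'rV[R]_(1 + n).
  apply/rowP => j; case: (split_ordP j) => j' ->; rewrite ?row_mxEl ?row_mxEr !mxE.
    by rewrite !ord1 !eqxx.
  by rewrite eq_rlshift andbF.
have dr k : delta_mx 0 (rshift 1 k) = row_mx 0%:M (delta_mx 0 k) :> 'rV[R]_(1 + n).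
  apply/rowP => j; case: (split_ordP j) => j' ->; rewrite ?row_mxEl ?row_mxEr !mxE.
    by rewrite eq_lrshift andbF mul0rn.
  by rewrite eq_rshift.
have vD : row_mx a%:M w *m 'D_(row_mx a%:M w) warped_gram p =
    row_mx 0 ((2 * f t * df * a) *: (w *m G y) + f t ^+ 2 *: (w *m 'D_w G y)).
  rewrite derive_warped_gram mul_row_block !mulmx0 !add0r.
  by rewrite mulmxDr -!scalemxAr.
have rowE : \row_l (row_mx a%:M w *m 'D_(delta_mx 0 l) warped_gram p
      *m (row_mx a%:M w)^T) 0 0 =
    row_mx (2 * f t * df * (w *m G y *m w^T) 0 0)%:M
      (f t ^+ 2 *: \row_l (w *m 'D_(delta_mx 0 l) G y *m w^T) 0 0).
  apply/rowP => l; rewrite [LHS]mxE.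
  case: (split_ordP l) => l' ->; rewrite ?row_mxEl ?row_mxEr.
    rewrite ord1 dl quad derive0 mulmx0 mul0mx scaler0 addr0 mulr1.
    by rewrite [LHS]mxE [RHS]mxE eqxx mulr1n.
  rewrite dr quad mulr0 scale0r add0r [LHS]mxE [RHS]mxE.
  by congr (_ * _); rewrite [RHS]mxE.
transitivity (row_mx 0 ((2 * f t * df * a) *: (w *m G y)
      + f t ^+ 2 *: (w *m 'D_w G y))
    - 2^-1 *: row_mx (2 * f t * df * (w *m G y *m w^T) 0 0)%:M
      (f t ^+ 2 *: \row_l (w *m 'D_(delta_mx 0 l) G y *m w^T) 0 0)).
  by rewrite -rowE -vD.
rewrite scale_row_mx opp_row_mx add_row_mx; congr row_mx.
  by rewrite sub0r scale_scalar_mx -raddfN /=; congr _%:M; field.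
by rewrite /lower_form scalerBr !scalerA [2^-1 * _]mulrC [RHS]addrC addrA.
Qed.

(** Both sides are compared after multiplication by the invertible matrix of the
    metric, where the left one becomes [lower_form_warped]. *)
Lemma christoffel_form_warped (a : R) (w : 'rV[R]_n) :
  christoffel_form warped_gram p (row_mx a%:M w) =
  row_mx (f t * df * (w *m G y *m w^T) 0 0)%:M
    (christoffel_form G y w + (2 * (df / f t) * a) *: w).
Proof.
apply: (can_inj (mulmxK warped_gram_unit)).
have sym : (warped_gram p)^T = warped_gram p.
  rewrite warped_gramE tr_block_mx !trmx0 tr_scalar_mx.
  by rewrite [(_ *: _)^T]linearZ /= G_sym.
rewrite christoffel_form_lower//; last exact: warped_gram_unit.
  rewrite lower_form_warped warped_gramE mul_row_block !mulmx0 addr0 add0r.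
  congr row_mx; first by rewrite -scalar_mxM mulrN1.
  rewrite -scalemxAr mulmxDl christoffel_form_lower// -scalemxAl.
  rewrite [RHS]scalerDr scalerA.
  by congr (_ + _ *: _); field.
exact: differentiable_warped_gram.
Qed.

End Warped.

(** * Speed of curves in a Riemannian manifold *)

Lemma quad_formZ {R : realType} n (k : R) (v : 'rV[R]_n) (G : 'M[R]_n) :
  ((k *: v) *m G *m (k *: v)^T) 0 0 = k ^+ 2 * (v *m G *m v^T) 0 0.
Proof.
rewrite [(k *: v)^T]linearZ /= -scalemxAr -!scalemxAl mxE [X in _ * X]mxE.
by rewrite mulrA -expr2.
Qed.

Section Speed.
Context {R : realType} {n : nat} {F : metric_atlas R n}.
Hypothesis F_riem : riemannian_manifold F.
Implicit Types (i j : chart_index F) (p : F) (c : R -> F) (s u : R).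

Lemma chart_cover p : exists i, chart_dom F i p.
Proof. by case: F_riem => -[]. Qed.

Lemma chart_nbhs i p : chart_dom F i p -> nbhs p (chart_dom F i).
Proof.
case: F_riem => -[_ _ _ dom_open _ _ _ _] _ _ _ _ ip.
by apply: open_nbhs_nbhs; split.
Qed.

Lemma chart_near {c : R -> F} {s i} : {for s, continuous c} ->
  chart_dom F i (c s) -> \forall u \near s, chart_dom F i (c u).
Proof. by move=> cc /chart_nbhs; exact: cc. Qed.

Lemma gram_differentiable i p : chart_dom F i p ->
  differentiable (gram F i) (chart F i p).
Proof.
case: F_riem => _ /(_ i 1%N)[gd _] _ _ _ ip.
by apply: gd; exists p.
Qed.

Lemma gram_sym i p : chart_dom F i p ->
  (gram F i (chart F i p))^T = gram F i (chart F i p).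
Proof. by case: F_riem => _ _ + _ _ => /[apply]. Qed.

Lemma gram_gt0 i p (v : 'rV[R]_n) : chart_dom F i p -> v != 0 ->
  0 < (v *m gram F i (chart F i p) *m v^T) 0 0.
Proof. by case: F_riem => _ _ _ + _ => /(_ i p v). Qed.

Lemma gram_ge0 i p (v : 'rV[R]_n) : chart_dom F i p ->
  0 <= (v *m gram F i (chart F i p) *m v^T) 0 0.
Proof.
move=> ip; have [->|v0] := eqVneq v 0; last by rewrite ltW// gram_gt0.
by rewrite !mul0mx mxE.
Qed.

Lemma gram_unitmx i p : chart_dom F i p ->
  gram F i (chart F i p) \in unitmx.
Proof. by move=> ip; apply: posdef_unitmx => v; exact: gram_gt0. Qed.

(** Injectivity of the chart [i] makes the point over given coordinates unique. *)
Lemma transitionE i j p : chart_dom F i p -> chart_dom F j p ->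
  @transition R n F i j (chart F i p) = chart F j p.
Proof.
case: F_riem => -[_ _ _ _ inj _ _ _] _ _ _ _ ip jp.
rewrite /transition; case: xgetP => [z _ [q [iq jq qp <-]]|].
  by congr (chart F j _); apply: (inj i); rewrite ?inE.
by move=> /(_ (chart F j p)) []; exists p.
Qed.

Lemma transition_differentiable i j p : chart_dom F i p -> chart_dom F j p ->
  differentiable (@transition R n F i j) (chart F i p).
Proof.
case: F_riem => -[_ _ _ _ _ _ _ /(_ i j 1%N)[td _]] _ _ _ _ ip jp.
by apply: td; exists p.
Qed.

Lemma is_derive_chart_change i j c s (v : 'rV[R]_n) :
  {for s, continuous c} -> chart_dom F i (c s) -> chart_dom F j (c s) ->
  is_derive s 1 (coord_curve i c) v ->
  is_derive s 1 (coord_curve j c)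
    (v *m jacobian (@transition R n F i j) (chart F i (c s))).
Proof.
move=> cc ip jp cd.
have td := transition_differentiable ip jp.
rewrite -deriveEjacobian//.
apply: near_eq_is_derive (is_derive_comp_diff cd td).
by apply: filterS2 (chart_near cc ip) (chart_near cc jp) => u; exact: transitionE.
Qed.

Definition chart_sqspeed i c s : R :=
  let v := derive1 (coord_curve i c) s in
  (v *m gram F i (chart F i (c s)) *m v^T) 0 0.

(** A chart-free value is needed because a curve may leave any given chart; by
    [sqspeedE] all charts around [c s] give the same number. *)
Definition sqspeed c s : R :=
  xget 0 [set e | exists2 i, chart_dom F i (c s) & e = chart_sqspeed i c s].

(** Velocities transform by the jacobian of the transition map, and the Gram
    matrices by the same jacobian. *)
Lemma sqspeedE i c s : {for s, continuous c} -> chart_dom F i (c s) ->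
  derivable (coord_curve i c) s 1 -> sqspeed c s = chart_sqspeed i c s.
Proof.
move=> cc ip cd; rewrite /sqspeed; case: xgetP => [e _ [j jp ->]|]; last first.
  by move=> /(_ (chart_sqspeed i c s))[]; exists i.
have /(is_derive_chart_change cc ip jp)/derive1P[_ vj] :
    is_derive s 1 (coord_curve i c) (derive1 (coord_curve i c) s).
  exact/derive1P.
rewrite /chart_sqspeed vj; case: F_riem => _ _ _ _ /(_ i j _ ip jp) ->.
by rewrite trmx_mul !mulmxA.
Qed.

Lemma sqspeed_is_derive i c s v : {for s, continuous c} ->
  chart_dom F i (c s) -> is_derive s 1 (coord_curve i c) v ->
  sqspeed c s = (v *m gram F i (chart F i (c s)) *m v^T) 0 0.
Proof. by move=> cc ip /derive1P[cd <-]; exact: sqspeedE. Qed.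

Lemma is_derive_sqspeed i c v w (lam : R) s :
  (\forall u \near s, {for u, continuous c}) -> chart_dom F i (c s) ->
  jet2 (coord_curve i c) v w s ->
  w + christoffel_form (gram F i) (chart F i (c s)) (v s) = lam *: v s ->
  is_derive s 1 (sqspeed c) (2 * lam * sqspeed c s).
Proof.
move=> ccN ip cJ acc; have cc := nbhs_singleton ccN.
rewrite (sqspeed_is_derive cc ip (jet2_derive cJ)).
have H := is_derive_sqnorm (gram_differentiable ip) (gram_sym ip)
  (gram_unitmx ip) cJ acc.
apply: near_eq_is_derive H; case: cJ => cdN _.
apply: filterS3 ccN (chart_near cc ip) cdN => u ccu iu cdu.
by rewrite (sqspeed_is_derive ccu iu cdu).
Qed.

Lemma sqspeed_reparam i c d (phi : R -> R) (dphi u : R) :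
  (\forall z \near u, d z = c (phi z)) ->
  {for u, continuous d} -> {for phi u, continuous c} ->
  chart_dom F i (c (phi u)) -> derivable (coord_curve i c) (phi u) 1 ->
  is_derive u 1 phi dphi ->
  sqspeed d u = dphi ^+ 2 * sqspeed c (phi u).
Proof.
move=> dE dc cc ip cd phid; have dEu := nbhs_singleton dE.
have /(is_derive_curve_comp)/(_ phid) H : is_derive (phi u) 1 (coord_curve i c)
    (derive1 (coord_curve i c) (phi u)) by exact/derive1P.
have dd : is_derive u 1 (coord_curve i d)
    (dphi *: derive1 (coord_curve i c) (phi u)).
  apply: near_eq_is_derive H.
  by apply: filterS dE => z; rewrite /coord_curve => ->.
have id : chart_dom F i (d u) by rewrite dEu.
by rewrite (sqspeed_is_derive dc id dd) (sqspeedE cc ip cd) /chart_sqspeed dEu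
  quad_formZ.
Qed.

End Speed.

Section GeodesicJets.
Context {R : realType} {n : nat} {M : metric_atlas R n}.

(** The geodesic property localized at a parameter, with velocity and
    acceleration packaged by [jet2]; it only depends on the germ of the curve
    ([geodesic_at_near_eq]), which is what makes gluing possible. *)
Definition geodesic_at (c : R -> M) (s : R) : Prop :=
  {for s, continuous c} /\
  forall i, chart_dom M i (c s) -> exists v w,
    jet2 (coord_curve i c) v w s /\
    w + christoffel_form (gram M i) (chart M i (c s)) (v s) = 0.

(** Openness of the chart domains turns derivability at every parameter into
    derivability near [s] of a single coordinate expression. *)
Lemma geodesicP (alpha beta : \bar R) (c : R -> M) :
  (forall (i : chart_index M), open (chart_dom M i)) ->
  geodesic alpha beta c <-> (alpha < beta)%E /\
    forall s, open_itv alpha beta s -> geodesic_at c s.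
Proof.
move=> dom_open; split=> -[ab cG]; split=> // s sI.
  have [cc _] := cG s sI; split=> // i ip.
  exists (derive1 (coord_curve i c)), (derive1 (derive1 (coord_curve i c)) s).
  have [_ /(_ i ip)[xd dxd acc]] := cG s sI; split.
    apply/jet2P; split=> //; last by near=> u.
    have ipN : \forall u \near s, chart_dom M i (c u).
      by apply: cc; apply: open_nbhs_nbhs; split.
    have sIN := open_itvP sI; near=> u.
    have uI : open_itv alpha beta u by near: u.
    have iu : chart_dom M i (c u) by near: u.
    case: (cG u uI) => _ /(_ i iu)[xdu _ _].
    exact: xdu.
  by apply/rowP => k; rewrite !mxE -[RHS](acc k).
have [cc cJ] := cG s sI; split=> // i ip /=.
have [v [w [xJ acc]]] := cJ i ip.
have /derive1P[xd xv] := jet2_derive xJ.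
have /jet2P[_ _ dxd xw] := xJ; split=> // k.
by have /rowP/(_ k) := acc; rewrite !mxE xv xw.
Unshelve. all: by end_near. Qed.

Lemma geodesic_at_near_eq (c d : R -> M) s :
  (\forall u \near s, c u = d u) -> geodesic_at c s -> geodesic_at d s.
Proof.
move=> cd [cc cJ]; have cds := nbhs_singleton cd; split.
  rewrite /prop_for /continuous_at -cds.
  by apply: cvg_trans cc; apply: near_eq_cvg; apply: filterS cd => u ->.
move=> i; rewrite -cds => /cJ[v [w [xJ acc]]]; exists v, w; split=> //.
apply: jet2_near_eq xJ; last by near=> u.
by apply: filterS cd => u; rewrite /coord_curve => ->.
Unshelve. all: by end_near. Qed.

End GeodesicJets.

(** * Geodesics of a warped product, in components *)

Section RowCurves.
Context {R : realType} {n : nat}.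

Lemma is_derive_row_mx (t : R -> R) (y : R -> 'rV[R]_n) dt dy (s : R) :
  is_derive s 1 t dt -> is_derive s 1 y dy ->
  is_derive s 1 (fun u => row_mx (t u)%:M (y u) : 'rV[R]_(1 + n))
    (row_mx dt%:M dy).
Proof.
move=> td /is_derive_mxP yd; apply/is_derive_mxP => i j.
case: (split_ordP j) => j' ->.
  under eq_fun do rewrite row_mxEl !ord1 mxE eqxx mulr1n.
  by rewrite row_mxEl !ord1 mxE eqxx mulr1n.
by under eq_fun do rewrite row_mxEr; rewrite row_mxEr.
Qed.

Lemma is_derive_lsubmx (x : R -> 'rV[R]_(1 + n)) dx (s : R) :
  is_derive s 1 x dx -> is_derive s 1 (fun u => lsubmx (x u) 0 0) (lsubmx dx 0 0).
Proof.
move=> /is_derive_mxP xd; under eq_fun do rewrite mxE.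
by rewrite [lsubmx dx 0 0]mxE.
Qed.

Lemma is_derive_rsubmx (x : R -> 'rV[R]_(1 + n)) dx (s : R) :
  is_derive s 1 x dx ->
  is_derive s 1 (fun u => rsubmx (x u) : 'rV[R]_n) (rsubmx dx).
Proof.
move=> /is_derive_mxP xd; apply/is_derive_mxP => i j.
by under eq_fun do rewrite mxE; rewrite [rsubmx dx i j]mxE.
Qed.

Lemma jet2_row_mx (t dt : R -> R) ddt (y v : R -> 'rV[R]_n) w s :
  jet2 t dt ddt s -> jet2 y v w s ->
  jet2 (fun u => row_mx (t u)%:M (y u) : 'rV[R]_(1 + n))
    (fun u => row_mx (dt u)%:M (v u)) (row_mx ddt%:M w) s.
Proof.
move=> [td dtd] [yd vd]; split; last exact: is_derive_row_mx.
by apply: filterS2 td yd => u; exact: is_derive_row_mx.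
Qed.

Lemma jet2_lsubmx (x v : R -> 'rV[R]_(1 + n)) w s : jet2 x v w s ->
  jet2 (fun u => lsubmx (x u) 0 0) (fun u => lsubmx (v u) 0 0) (lsubmx w 0 0) s.
Proof.
move=> [xd vd]; split; last exact: is_derive_lsubmx.
by apply: filterS xd => u; exact: is_derive_lsubmx.
Qed.

Lemma jet2_rsubmx (x v : R -> 'rV[R]_(1 + n)) w s : jet2 x v w s ->
  jet2 (fun u => rsubmx (x u) : 'rV[R]_n) (fun u => rsubmx (v u)) (rsubmx w) s.
Proof.
move=> [xd vd]; split; last exact: is_derive_rsubmx.
by apply: filterS xd => u; exact: is_derive_rsubmx.
Qed.

Lemma row_mx_block_quad (a b k : R) (w u : 'rV[R]_n) (G : 'M[R]_n) :
  (row_mx a%:M w *m block_mx (-1)%:M 0 0 (k *: G) *m (row_mx b%:M u)^T) 0 0 =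
  - (a * b) + k * (w *m G *m u^T) 0 0.
Proof.
rewrite mul_row_block !mulmx0 addr0 add0r tr_row_mx mul_row_col.
rewrite tr_scalar_mx -!scalar_mxM -scalemxAr -scalemxAl.
by rewrite [LHS]mxE; congr (_ + _); rewrite mxE ?eqxx ?mulr1n// mulrN1 mulNr.
Qed.

End RowCurves.

Section WarpedGeodesics.
Context {R : realType} {n : nat} {F : metric_atlas R n}.
Variables (I : set R) (f : R -> R).
Hypothesis F_riem : riemannian_manifold F.
Hypothesis f_diff : forall x, I x -> differentiable f x.
Hypothesis f_gt0 : forall x, I x -> 0 < f x.
Notation M := (grw I f F).

Definition time_of (c : R -> M) (s : R) : R := set_val (c s).1.
Definition fiber_of (c : R -> M) (s : R) : F := (c s).2.

Lemma time_ofP c s : I (time_of c s).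
Proof. by apply: set_mem; exact: valP. Qed.

Lemma f_is_derive x : I x -> is_derive x 1 f (derive1 f x).
Proof.
by move=> /f_diff fd; rewrite derive1E; apply/derivableP/derivable1_diffP.
Qed.

Lemma grw_chart_open (i : chart_index M) : open (chart_dom M i).
Proof.
case: F_riem => -[_ _ _ /(_ i) + _ _ _ _] _ _ _ _.
by move=> /(@open_comp _ _ (@snd (set_type I) F)); apply => x _; exact: cvg_snd.
Qed.

Lemma fiber_of_continuous c s :
  {for s, continuous c} -> {for s, continuous (fiber_of c)}.
Proof.
by move=> cc; apply: (@continuous_comp _ _ _ c snd) => //; exact: cvg_snd.
Qed.

Lemma grw_continuous c s :
  {for s, continuous (time_of c)} -> {for s, continuous (fiber_of c)} ->
  {for s, continuous c}.
Proof.
move=> tc qc.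
have c1 : {for s, continuous (fst \o c)}.
  move=> U [_ [[W oW <-] Ws sWU]].
  have tW : \forall u \near s, W (time_of c u) := tc W (open_nbhs_nbhs (conj oW Ws)).
  suff : \forall u \near s, U (c u).1 by [].
  by apply: filterS tW => u Wu; exact: sWU.
have -> : c = (fun u => ((c u).1, (c u).2)).
  by apply/funext => u; case: (c u).
exact: (cvg_pair c1 qc).
Qed.

(** Splitting [christoffel_form_warped] into its time and fibre components; the
    converse is [geodesic_at_grwE]. *)
Lemma geodesic_at_grwI c s :
  {for s, continuous (time_of c)} -> {for s, continuous (fiber_of c)} ->
  (forall i, chart_dom F i (fiber_of c s) -> exists dt ddt v w,
    [/\ jet2 (time_of c) dt ddt s,
        jet2 (coord_curve i (fiber_of c)) v w s,
        ddt + f (time_of c s) * derive1 f (time_of c s) *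
          (v s *m gram F i (chart F i (fiber_of c s)) *m (v s)^T) 0 0 = 0 &
        w + christoffel_form (gram F i) (chart F i (fiber_of c s)) (v s) =
        - (2 * (derive1 f (time_of c s) / f (time_of c s)) * dt s) *: v s]) ->
  geodesic_at c s.
Proof.
move=> tc qc cJ; split; first exact: grw_continuous.
move=> i ip; have [dt [ddt [v [w [tJ yJ eqt eqy]]]]] := cJ i ip.
have fs := f_is_derive (time_ofP c s).
have fs0 : f (time_of c s) != 0 by rewrite gt_eqF// f_gt0//; exact: time_ofP.
exists (fun u => row_mx (dt u)%:M (v u)), (row_mx ddt%:M w); split.
  exact: jet2_row_mx tJ yJ.
rewrite -[gram M i]/(warped_gram f (gram F i)).
rewrite -[chart M i (c s)]/(row_mx (time_of c s)%:M (chart F i (fiber_of c s))).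
rewrite (christoffel_form_warped fs)//; [|exact: gram_differentiable
  |exact: gram_sym|exact: gram_unitmx].
rewrite add_row_mx -raddfD /= eqt addrA eqy -scalerDl addNr scale0r.
by rewrite raddf0 row_mx0.
Qed.

Lemma geodesic_at_grwE c s i : geodesic_at c s ->
  chart_dom F i (fiber_of c s) -> exists ddt w,
    [/\ jet2 (time_of c) (derive1 (time_of c)) ddt s,
        jet2 (coord_curve i (fiber_of c))
             (derive1 (coord_curve i (fiber_of c))) w s,
        ddt = - (f (time_of c s) * derive1 f (time_of c s) *
          sqspeed (fiber_of c) s) &
        w + christoffel_form (gram F i) (chart F i (fiber_of c s))
              (derive1 (coord_curve i (fiber_of c)) s) =
        - (2 * (derive1 f (time_of c s) / f (time_of c s)) *
           derive1 (time_of c) s) *: derive1 (coord_curve i (fiber_of c)) s].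
Proof.
move=> [cc cJ] ip; have [v [w [xJ acc]]] := cJ i ip.
have qc := fiber_of_continuous cc.
have fs := f_is_derive (time_ofP c s).
have fs0 : f (time_of c s) != 0 by rewrite gt_eqF// f_gt0//; exact: time_ofP.
have xE : @coord_curve R (1 + n) M i c =
    (fun u => row_mx (time_of c u)%:M (coord_curve i (fiber_of c) u)) by [].
have tJ : jet2 (time_of c) (fun u => lsubmx (v u) 0 0) (lsubmx w 0 0) s.
  apply: jet2_near_eq (jet2_lsubmx xJ); last by near=> u.
  by near=> u; rewrite xE row_mxKl mxE.
have yJ : jet2 (coord_curve i (fiber_of c)) (fun u => rsubmx (v u)) (rsubmx w) s.
  apply: jet2_near_eq (jet2_rsubmx xJ); last by near=> u.
  by near=> u; rewrite xE row_mxKr.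
have [tJ' tE] := jet2_derive1 tJ; have [yJ' yE] := jet2_derive1 yJ.
have split_row (z : 'rV[R]_(1 + n)) : z = row_mx (lsubmx z 0 0)%:M (rsubmx z).
  by rewrite -mx11_scalar hsubmxK.
move: acc; rewrite -[gram M i]/(warped_gram f (gram F i)).
rewrite -[chart M i (c s)]/(row_mx (time_of c s)%:M (chart F i (fiber_of c s))).
rewrite (split_row (v s)) (split_row w).
rewrite (christoffel_form_warped fs)//; [|exact: gram_differentiable
  |exact: gram_sym|exact: gram_unitmx].
rewrite -tE -yE add_row_mx -raddfD /= -[RHS]row_mx0 => /eq_row_mx[eqt eqy].
exists (lsubmx w 0 0), (rsubmx w); split=> //.
  rewrite (sqspeed_is_derive F_riem qc ip (jet2_derive yJ)).
  rewrite yE in eqt *; apply/eqP; rewrite -addr_eq0; apply/eqP.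
  by have /matrixP/(_ 0 0) := eqt; rewrite !mxE eqxx !mulr1n.
by apply/eqP; rewrite scaleNr -addr_eq0 -addrA; apply/eqP.
Unshelve. all: by end_near. Qed.

End WarpedGeodesics.

(** * Conserved quantities and extension of geodesics *)

Section FirstIntegralsAndExtension.
Context {R : realType} {n : nat} {F : metric_atlas R n}.
Variables (I : set R) (f : R -> R).
Hypothesis F_riem : riemannian_manifold F.
Hypothesis f_diff : forall x, I x -> differentiable f x.
Hypothesis f_gt0 : forall x, I x -> 0 < f x.
Notation M := (grw I f F).

(** [is_derive_sqspeed] with acceleration [0]. *)
Lemma sqspeed_geodesic_constant (gamma : R -> F) (alpha beta : \bar R) x y :
  geodesic alpha beta gamma ->
  open_itv alpha beta x -> open_itv alpha beta y ->
  sqspeed gamma x = sqspeed gamma y.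
Proof.
have dom_open i : open (chart_dom F i) by case: F_riem => -[].
move=> /(geodesicP _ _ _ dom_open)[_ gG]; apply: derive0_constant => s sI.
have [gc gJ] := gG s sI; have [i ip] := chart_cover F_riem (gamma s).
have [v [w [gammaJ acc]]] := gJ i ip.
have H := @is_derive_sqspeed _ _ _ F_riem i gamma v w 0 s.
apply: is_derive_eq (H _ ip gammaJ _) _.
- by apply: filterS (open_itvP sI) => u /gG[].
- by rewrite scale0r.
- by rewrite mulr0 mul0r.
Qed.

Section FirstIntegrals.
Variables (c : R -> M) (s : R).
Hypothesis c_geod : \forall u \near s, geodesic_at c u.
Let t := time_of c.
Let q := fiber_of c.
Let lam := - (2 * (derive1 f (t s) / f (t s)) * derive1 t s).

Let f_neq0 : f (t s) != 0.
Proof. by rewrite gt_eqF// f_gt0//; exact: (time_ofP c s). Qed.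

Lemma is_derive_time : is_derive s 1 t (derive1 t s).
Proof.
have cs := nbhs_singleton c_geod.
have [i ip] := chart_cover F_riem (q s).
by have [ddt [w [/jet2_derive]]] := geodesic_at_grwE F_riem f_diff f_gt0 cs ip.
Qed.

Lemma is_derive_warping : is_derive s 1 (fun u => f (t u))
  (derive1 f (t s) * derive1 t s).
Proof.
apply: is_derive_compr is_derive_time.
exact: f_is_derive f_diff _ (time_ofP c s).
Qed.

Lemma is_derive_time_derive1 : is_derive s 1 (derive1 t)
  (- (f (t s) * derive1 f (t s) * sqspeed q s)).
Proof.
have cs := nbhs_singleton c_geod.
have [i ip] := chart_cover F_riem (q s).
by have [ddt [w [[_ td] _ <- _]]] := geodesic_at_grwE F_riem f_diff f_gt0 cs ip.
Qed.

Lemma is_derive_fiber_sqspeed : is_derive s 1 (sqspeed q)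
  (2 * lam * sqspeed q s).
Proof.
have cs := nbhs_singleton c_geod.
have [i ip] := chart_cover F_riem (q s).
have [ddt [w [_ yJ _ eqy]]] := geodesic_at_grwE F_riem f_diff f_gt0 cs ip.
apply: (is_derive_sqspeed F_riem _ ip yJ eqy).
by apply: filterS c_geod => u [/fiber_of_continuous].
Qed.

(** The factor [f^4] compensates the rate [- 4 (f'/f) t'] at which the squared
    speed of the fibre component decays. *)
Lemma is_derive_momentum :
  is_derive s 1 (fun u => (f (t u) ^+ 2) ^+ 2 * sqspeed q u) 0.
Proof.
have H := is_derive_mulr (is_derive_sqr (is_derive_sqr is_derive_warping))
  is_derive_fiber_sqspeed.
by apply: is_derive_eq H _; rewrite /lam; field.
Qed.

(** The quantity is the squared length of the velocity up to sign, which is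
    constant along any geodesic. *)
Lemma is_derive_energy :
  is_derive s 1 (fun u => derive1 t u ^+ 2 - f (t u) ^+ 2 * sqspeed q u) 0.
Proof.
have H := is_derive_subr (is_derive_sqr is_derive_time_derive1)
  (is_derive_mulr (is_derive_sqr is_derive_warping) is_derive_fiber_sqspeed).
by apply: is_derive_eq H _; rewrite /lam; field.
Qed.

End FirstIntegrals.

(** The value of [t'] at time [x], obtained by eliminating the fibre speed from
    the first integrals [E] and [K]. *)
Definition time_speed (E K x : R) : R := Num.sqrt (E + K * (f x ^+ 2)^-1).

Section TimeSpeed.
Variables (E K : R).
Hypothesis E_gt0 : 0 < E.
Hypothesis K_ge0 : 0 <= K.

Lemma time_speed_arg_gt0 x : 0 < E + K * (f x ^+ 2)^-1.
Proof. by rewrite ltr_wpDr// mulr_ge0// invr_ge0 sqr_ge0. Qed.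

Lemma time_speed_gt0 x : 0 < time_speed E K x.
Proof. by rewrite sqrtr_gt0 time_speed_arg_gt0. Qed.

Lemma is_derive_time_speed x : I x ->
  is_derive x 1 (time_speed E K)
    (- (K * derive1 f x / (f x ^+ 3 * time_speed E K x))).
Proof.
move=> Ix; have fx := f_is_derive f_diff Ix.
have f0 : f x != 0 by rewrite gt_eqF// f_gt0.
have f20 : f x ^+ 2 != 0 by rewrite expf_neq0.
have d1 := @is_derive_invr _ (fun u => f u ^+ 2) _ _ f20 (is_derive_sqr fx).
have d2 := is_derive_mulr (is_derive_cst K x 1) d1.
have d3 := is_deriveD (is_derive_cst E x 1) d2.
have d4 := @is_derive_compr _ Num.sqrt (fun u => E + K * (f u ^+ 2)^-1) x _ _
  (is_derive1_sqrt (time_speed_arg_gt0 x)) d3.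
apply: is_derive_eq d4 _; rewrite -/(time_speed E K x).
have s0 : time_speed E K x != 0 by rewrite gt_eqF// time_speed_gt0.
rewrite /cst /=; field.
by rewrite f0 s0.
Qed.

Lemma time_speed_le C x : 0 < C -> C <= f x ->
  time_speed E K x <= Num.sqrt (E + K * (C ^+ 2)^-1).
Proof.
move=> C_gt0 Cf; rewrite ler_wsqrtr// lerD2l ler_wpM2l//.
have f_gt : 0 < f x by exact: lt_le_trans Cf.
by rewrite lef_pV2 ?posrE ?exprn_gt0// lerXn2r ?nnegrE// ltW.
Qed.

End TimeSpeed.

(** In a product chart [g(c', c') < 0] reads [E > 0], and [g(c', d_t) < 0] reads
    [t' > 0]; the latter selects the positive root of [t'^2 = E + K / f(t)^2]. *)
Lemma timelike_first_integrals (alpha beta : \bar R) (c : R -> M) :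
  geodesic alpha beta c -> timelike alpha beta c ->
  future_directed alpha beta c ->
  (exists s, open_itv alpha beta s) ->
  exists E K, [/\ 0 < E, 0 <= K & forall s, open_itv alpha beta s ->
    is_derive s 1 (time_of c) (time_speed E K (time_of c s)) /\
    (f (time_of c s) ^+ 2) ^+ 2 * sqspeed (fiber_of c) s = K].
Proof.
move=> /(geodesicP _ _ _ (@grw_chart_open _ _ _ I f F_riem))[_ cG] cT cFD [s0 s0I].
have cGN s : open_itv alpha beta s -> \forall u \near s, geodesic_at c u.
  by move=> /open_itvP; apply: filterS => u /cG.
pose t := time_of c; pose q := fiber_of c.
pose K s := (f (t s) ^+ 2) ^+ 2 * sqspeed q s.
pose E s := derive1 t s ^+ 2 - f (t s) ^+ 2 * sqspeed q s.
have KE s : open_itv alpha beta s -> K s = K s0.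
  move=> sI; apply: (derive0_constant _ sI s0I) => u uI.
  exact: is_derive_momentum (cGN u uI).
have EE s : open_itv alpha beta s -> E s = E s0.
  move=> sI; apply: (derive0_constant _ sI s0I) => u uI.
  exact: is_derive_energy (cGN u uI).
have causal s : open_itv alpha beta s ->
    [/\ 0 < E s, 0 <= sqspeed q s & 0 < derive1 t s].
  move=> sI; have [i ip] := chart_cover F_riem (q s).
  have [ddt [w [tJ yJ _ _]]] := geodesic_at_grwE F_riem f_diff f_gt0 (cG s sI) ip.
  have [/fiber_of_continuous qc _] := cG s sI.
  have td := jet2_derive tJ; have yd := jet2_derive yJ.
  have /derive1P[_ vE] := is_derive_row_mx td yd.
  have sqE := sqspeed_is_derive F_riem qc ip yd.
  have gramE : gram M i (chart M i (c s)) =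
      block_mx (-1)%:M 0 0 (f (t s) ^+ 2 *: gram F i (chart F i (q s))).
    exact: warped_gramE.
  have xE : derive1 (@coord_curve R (1 + n) M i c) s =
      row_mx (derive1 t s)%:M (derive1 (coord_curve i q) s).
    exact: vE.
  have tl : (derive1 (@coord_curve R (1 + n) M i c) s *m gram M i (chart M i (c s))
      *m (derive1 (@coord_curve R (1 + n) M i c) s)^T) 0 0 < 0.
    exact: cT.
  have fd : (derive1 (@coord_curve R (1 + n) M i c) s *m gram M i (chart M i (c s))
      *m (row_mx 1%:M 0)^T) 0 0 < 0.
    exact: cFD.
  move: tl fd; rewrite xE gramE !row_mx_block_quad -sqE.
  rewrite trmx0 mulmx0 mxE mulr0 addr0 mulr1 oppr_lt0 => tl t_gt0; split=> //.
    by rewrite /E expr2; lra.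
  rewrite sqE; exact: gram_ge0.
exists (E s0), (K s0); split.
- by case: (causal s0 s0I).
- by have [_ sq_ge0 _] := causal s0 s0I; rewrite mulr_ge0// sqr_ge0.
move=> s sI; split; last exact: KE.
have [_ _ t_gt0] := causal s sI.
have f0 : f (t s) != 0 by rewrite gt_eqF// f_gt0//; exact: (time_ofP c s).
suff -> : time_speed (E s0) (K s0) (time_of c s) = derive1 t s.
  exact: is_derive_time (cGN s sI).
rewrite /time_speed -(EE s sI) -(KE s sI) -/t.
have -> : E s + K s * (f (t s) ^+ 2)^-1 = derive1 t s ^+ 2.
  by rewrite /E /K; field.
by rewrite sqrtr_sqr gtr0_norm.
Qed.

(** The curve is [gamma = q o psi] with [psi] inverse to [r].  Since
    [psi' = f(t)^2], the term [psi''] equals [2 (f'/f) t' psi'^2] and cancels the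
    tangential acceleration of [q]. *)
Lemma fiber_reparam_geodesic (c : R -> M) (s0 s1 s2 : R) (r dr : R -> R) :
  s0 < s1 -> s1 < s2 ->
  (forall s, s0 < s < s2 -> geodesic_at c s) ->
  (forall s, s0 < s -> is_derive s 1 r (dr s)) ->
  (forall s, s0 < s -> 0 < dr s) ->
  (forall s, s0 < s < s2 -> dr s = (f (time_of c s) ^+ 2)^-1) ->
  exists gamma : R -> F, geodesic (r s1)%:E (r s2)%:E gamma /\
    forall s, s1 < s < s2 -> gamma (r s) = fiber_of c s.
Proof.
move=> s01 s12 cG rd dr_gt0 drE.
have [psi psiP] := exists_inverse rd dr_gt0.
have r12 : r s1 < r s2 by exact: derive_gt0_lt rd dr_gt0 _ _ s01 s12.
have onto u : open_itv (r s1)%:E (r s2)%:E u ->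
    exists2 s, s1 < s < s2 & r s = u.
  rewrite /open_itv /= !lte_fin => -[ru ur].
  by apply: (derive_gt0_IVT rd dr_gt0 s01 s12); rewrite ru.
exists (fiber_of c \o psi); split; last first.
  by move=> s /andP[s1s _] /=; have [-> _] := psiP s (lt_trans s01 s1s).
have dom_open i : open (chart_dom F i) by case: F_riem => -[].
apply/geodesicP => //; rewrite lte_fin; split=> // u uI.
have [s /andP[s1s ss2] ru] := onto u uI.
have s0s : s0 < s by exact: lt_trans s1s.
have sI : s0 < s < s2 by rewrite s0s.
have sIN : \forall z \near s, s0 < z < s2.
  near=> z; apply/andP; split; near: z; [exact: lt_nbhsr|exact: lt_nbhsl].
have cGN : \forall z \near s, geodesic_at c z by apply: filterS sIN.
have [psiK psid] := psiP s s0s; rewrite ru in psiK psid.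
pose t := time_of c; pose dpsi z := f (t (psi z)) ^+ 2.
have psiN : \forall z \near u, is_derive z (1 : R) psi (dpsi z).
  apply: filterS (open_itvP uI) => z /onto[s' /andP[s1s' s's2] <-].
  have s0s' : s0 < s' by exact: lt_trans s1s'.
  have [psiK' psid'] := psiP s' s0s'.
  by apply: is_derive_eq psid' _; rewrite /dpsi psiK' drE ?invrK ?s0s'.
have psiJ : jet2 psi dpsi (2 * f (t s) * (derive1 f (t s) * derive1 t s)
    * f (t s) ^+ 2) u.
  split=> //.
  have wd := is_derive_sqr (is_derive_warping cGN).
  rewrite -psiK in wd.
  apply: is_derive_eq (is_derive_compr wd (nbhs_singleton psiN)) _.
  by rewrite /dpsi psiK.
have cs := cG s sI.
have qc : {for u, continuous (fiber_of c \o psi)}.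
  apply: continuous_comp; first exact: is_derive_continuous psid.
  by rewrite psiK; apply: fiber_of_continuous; case: cs.
split=> // i; rewrite /= psiK => ip.
have [ddt [w [_ yJ _ eqy]]] := geodesic_at_grwE F_riem f_diff f_gt0 cs ip.
have f0 : f (t s) != 0 by rewrite gt_eqF// f_gt0//; exact: (time_ofP c s).
rewrite -psiK in yJ eqy.
have [w' [xJ acc]] := christoffel_reparam yJ psiJ eqy.
eexists; exists w'; split; first exact: xJ.
rewrite -[chart F i _]/(coord_curve i (fiber_of c) s) -psiK.
rewrite [LHS]acc /dpsi psiK -/t.
set k := (X in X *: _); suff -> : k = 0 by rewrite scale0r.
by rewrite /k; field.
Unshelve. all: by end_near. Qed.

(** The converse of the two reductions.  The constant [K] in the equation of [T]
    has to be the squared speed of [gamma]: the squared speed of [gamma o r] is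
    then [K / f(T)^4], as the equation [T'' = - f f' K / f^4] demands. *)
Lemma grw_geodesic_at_lift (e : R -> M) (T r : R -> R) (gamma : R -> F)
    (E K s : R) :
  0 < E -> 0 <= K ->
  (\forall u \near s, time_of e u = T u) ->
  (\forall u \near s, fiber_of e u = gamma (r u)) ->
  (\forall u \near s, is_derive u (1 : R) T (time_speed E K (T u))) ->
  (\forall u \near s, is_derive u (1 : R) r ((f (T u) ^+ 2)^-1)) ->
  geodesic_at gamma (r s) -> sqspeed gamma (r s) = K ->
  geodesic_at e s.
Proof.
move=> E_gt0 K_ge0 eT eq TdN rdN [gammac gammaJ] gammaK.
have Td := nbhs_singleton TdN; have rd := nbhs_singleton rdN.
have TsE := nbhs_singleton eT; have qsE := nbhs_singleton eq.
have IT : I (T s) by rewrite -TsE; exact: time_ofP.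
have f0 : f (T s) != 0 by rewrite gt_eqF// f_gt0.
have sp0 : time_speed E K (T s) != 0 by rewrite gt_eqF// time_speed_gt0.
have TE : \forall u \near s, T u = time_of e u by apply: filterS eT => u ->.
have qE : \forall u \near s, gamma (r u) = fiber_of e u.
  by apply: filterS eq => u ->.
have TJ : jet2 (time_of e) (fun u => time_speed E K (T u))
    (- (K * derive1 f (T s) / f (T s) ^+ 3)) s.
  apply: (@jet2_near_eq _ _ T _ (fun u => time_speed E K (T u))) => //.
    by near=> u.
  split=> //.
  have spd := is_derive_time_speed E_gt0 K_ge0 IT.
  by apply: is_derive_eq (is_derive_compr spd Td) _; field; rewrite f0 sp0.
have fTd : is_derive s 1 (fun u => f (T u)) (derive1 f (T s) * time_speed E K (T s)).
  exact: is_derive_compr (f_is_derive f_diff IT) Td.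
have rJ : jet2 r (fun u => (f (T u) ^+ 2)^-1)
    (- (2 * derive1 f (T s) * time_speed E K (T s) / f (T s) ^+ 3)) s.
  split=> //; have f20 : f (T s) ^+ 2 != 0 by rewrite expf_neq0.
  apply: is_derive_eq (@is_derive_invr _ (fun u => f (T u) ^+ 2) _ _ f20
    (is_derive_sqr fTd)) _.
  by field.
apply: geodesic_at_grwI => //.
- exact: is_derive_continuous (jet2_derive TJ).
- have gc : {for s, continuous (gamma \o r)}.
    by apply: continuous_comp => //; exact: is_derive_continuous rd.
  rewrite /prop_for /continuous_at -(nbhs_singleton qE).
  by apply: cvg_trans gc; apply: near_eq_cvg; apply: filterS qE => u /= ->.
move=> i ip; have ip' : chart_dom F i (gamma (r s)) by rewrite -qsE.
have [v [w [yJ acc]]] := gammaJ i ip'.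
have acc0 : w + christoffel_form (gram F i) (coord_curve i gamma (r s)) (v (r s))
    = 0 *: v (r s) by rewrite scale0r.
have [w' [xJ acc']] := christoffel_reparam yJ rJ acc0.
exists (fun u => time_speed E K (T u)); eexists.
exists (fun z => (f (T z) ^+ 2)^-1 *: v (r z)), w'; split.
- exact: TJ.
- apply: jet2_near_eq xJ; last by near=> u.
  by apply: filterS qE => u /=; rewrite /coord_curve => ->.
- rewrite TsE qsE quad_formZ.
  rewrite -(sqspeed_is_derive F_riem gammac ip' (jet2_derive yJ)) gammaK.
  by field.
rewrite TsE qsE [LHS]acc' scalerA; congr (_ *: _).
by field.
Unshelve. all: by end_near. Qed.

End FirstIntegralsAndExtension.

(** * Future completeness *)

Theorem theorem6p4 (R : realType) (n : nat) (F : metric_atlas R n)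
    (a : \bar R) (f : R -> R)
    (F_riemannian : riemannian_manifold F)
    (F_complete : geodesically_complete F)
    (a_lt_oo : (a < +oo)%E)
    (f_smooth : smooth_on (open_itv a +oo%E) f)
    (f_gt0 : forall t, open_itv a +oo%E t -> 0 < f t)
    (f_ge : exists t1 C : R, 0 < C /\
       forall t, open_itv a +oo%E t -> t1 <= t -> C <= f t) :
  forall (alpha beta : \bar R) (c : R -> grw (open_itv a +oo%E) f F),
    geodesic alpha beta c ->
    timelike alpha beta c ->
    future_directed alpha beta c ->
    future_complete alpha beta c.
Proof.
move=> alpha [b| |] c cG cT cFD; first last.
- by case: cG; rewrite ltNge leNye.
- by exists c; split.
set I := open_itv a +oo%E in c cG cT cFD f_gt0 f_ge f_smooth *.
have f_diff x : I x -> differentiable f x by case: (f_smooth 1%N) => + _; exact.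
have [t1 [C [C_gt0 fC]]] := f_ge.
have dom_open (i : chart_index (grw I f F)) : open (chart_dom (grw I f F) i).
  exact: grw_chart_open.
have [alpha_b cGat] := (geodesicP _ _ _ dom_open).1 cG.
have [s0 s0J] := open_itv_inhabited alpha_b.
have [E [K [E_gt0 K_ge0 cEK]]] := timelike_first_integrals F_riemannian f_diff
  f_gt0 cG cT cFD (ex_intro _ s0 s0J).
have s0b : s0 < b by have [_] := s0J; rewrite lte_fin.
have J_of s : s0 <= s -> s < b -> open_itv alpha b%:E s.
  move=> s0s sb; have [as0 _] := s0J; split; last by rewrite lte_fin.
  by apply: lt_le_trans as0 _; rewrite lee_fin.
pose t := time_of c; pose q := fiber_of c; pose x0 := t s0.
have x0I x : x0 <= x -> I x.
  move=> x0x; have [ax0 _] := time_ofP c s0; split; last exact: ltry.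
  by apply: lt_le_trans ax0 _; rewrite lee_fin.
(* The time component stays above its initial value x0, so that only the
   half-line x >= x0 of I matters, on which f is defined and positive. *)
have tP s : s0 < s < b -> x0 < t s /\ is_derive s 1 t (time_speed f E K (t s)).
  move=> /andP[s0s sb]; have [td _] := cEK s (J_of s (ltW s0s) sb); split=> //.
  have [|z _ tE] := @mean_value _ t (fun z => time_speed f E K (t z)) s0 s s0s.
    by move=> z /andP[s0z zs]; case: (cEK z (J_of z s0z (le_lt_trans zs sb))).
  by rewrite -subr_gt0 tE mulr_gt0 ?subr_gt0// time_speed_gt0.
have speed_cont x : x0 <= x -> {for x, continuous (time_speed f E K)}.
  move=> /x0I Ix.
  exact: is_derive_continuous (is_derive_time_speed f_diff f_gt0 E_gt0 K_ge0 Ix).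
have speed_gt0 x : x0 <= x -> 0 < time_speed f E K x.
  by move=> _; exact: time_speed_gt0.
have speed_le x : x0 <= x -> t1 <= x ->
    time_speed f E K x <= Num.sqrt (E + K * (C ^+ 2)^-1).
  by move=> /x0I Ix t1x; apply: time_speed_le => //; exact: fC.
have [T [Tt TP]] := autonomous_extension speed_cont speed_gt0 speed_le s0b tP.
have IT s : s0 < s -> I (T s) by move=> /TP[/ltW/x0I].
(* The points s0 < s1 < s2 < s3 < b are successive starting points: T is defined
   after s0, r after s1, gamma agrees with q o r^-1 after r s2, and s3 is a point
   where c and its extension can be compared. *)
pose s1 := (s0 + b) / 2.
have s01 : s0 < s1 by rewrite midf_lt.
have s1b : s1 < b by rewrite midf_lt.
pose s2 := (s1 + b) / 2.
have s12 : s1 < s2 by rewrite midf_lt.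
have s2b : s2 < b by rewrite midf_lt.
pose s3 := (s2 + b) / 2.
have s23 : s2 < s3 by rewrite midf_lt.
have s3b : s3 < b by rewrite midf_lt.
have fT_neq0 s : s0 < s -> f (T s) ^+ 2 != 0.
  by move=> /IT Is; rewrite expf_neq0// gt_eqF// f_gt0.
have [s s1s|r rd] := @exists_antiderivative _ s1 (fun s => (f (T s) ^+ 2)^-1).
  have s0s : s0 < s by exact: lt_le_trans s1s.
  have [_ Td] := TP s s0s.
  have fTd := is_derive_compr (f_is_derive f_diff (IT s s0s)) Td.
  exact: is_derive_continuous (@is_derive_invr _ (fun u => f (T u) ^+ 2) _ _
    (fT_neq0 s s0s) (is_derive_sqr fTd)).
have dr_gt0 s : s1 < s -> 0 < (f (T s) ^+ 2)^-1.
  move=> s1s; have s0s : s0 < s by exact: lt_trans s1s.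
  by rewrite invr_gt0 exprn_gt0// f_gt0//; exact: IT.
have [||gamma0 [gamma0G gamma0E]] := @fiber_reparam_geodesic _ _ _ I f
    F_riemannian f_diff f_gt0 c s1 s2 b r _ s12 s2b _ rd dr_gt0 _.
- move=> s /andP[s1s sb]; apply: cGat; apply: J_of => //.
  by rewrite ltW// (lt_trans s01).
- by move=> s /andP[s1s sb]; rewrite Tt// (lt_trans s01 s1s).
have [gamma [gammaG gammaE]] := F_complete _ _ _ gamma0G.
have r_incr := derive_gt0_lt rd dr_gt0.
have gamma_q s : s2 < s < b -> gamma (r s) = q s.
  move=> sP; rewrite /q -gamma0E//; apply: gammaE.
  move: sP => /andP[s2s sb]; rewrite /open_itv /= !lte_fin.
  by rewrite !r_incr// (lt_trans s12).
have Tt' s : s2 < s < b -> T s = t s.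
  move=> /andP[s2s sb]; apply: Tt.
  by rewrite sb andbT (lt_trans _ s2s)// (lt_trans s01).
have itvT u : open_itv (-oo)%E (+oo)%E (u : R).
  by split; [exact: ltNyr|exact: ltry].
have F_open i : open (chart_dom F i) by case: F_riemannian => -[].
have [_ gammaGat] := (geodesicP _ _ _ F_open).1 gammaG.
have s02 : s0 < s2 by exact: lt_trans s12.
(* At s3 the speed of gamma is determined by that of q = gamma o r. *)
have gamma_speed u : sqspeed gamma u = K.
  rewrite (sqspeed_geodesic_constant F_riemannian gammaG (itvT u) (itvT (r s3))).
  have s03 : s0 < s3 by exact: lt_trans s23.
  have s3J : open_itv alpha b%:E s3 by apply: J_of; rewrite // ltW.
  have [_ KE] := cEK s3 s3J.
  have [gc gJ] := gammaGat (r s3) (itvT _).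
  have [i ip] := chart_cover F_riemannian (gamma (r s3)).
  have [v [w [/jet2_derive/derive1P[gd _] _]]] := gJ i ip.
  have qc : {for s3, continuous q}.
    by apply: fiber_of_continuous; case: (cGat _ s3J).
  have qE : \forall z \near s3, q z = gamma (r z).
    near=> z; rewrite gamma_q//; apply/andP.
    by split; near: z; [exact: lt_nbhsr|exact: lt_nbhsl].
  have s13 : s1 < s3 by exact: lt_trans s23.
  have H := sqspeed_reparam F_riemannian qE qc gc ip gd (rd s3 s13).
  rewrite -KE -/q H -/t -Tt'; last by rewrite s23.
  by have := fT_neq0 s3 s03; move: (f (T s3) ^+ 2) => k k0; field.
(* Outside of I the value of proj is arbitrary; T stays in I. *)
have Ix0 : x0 \in I by apply/mem_set; apply: x0I.
pose proj x : set_type I := insubd (exist _ x0 Ix0) x.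
have projE x : I x -> set_val (proj x) = x.
  by move=> /mem_set Ix; rewrite /proj set_valE val_insubd Ix.
pose ext s : grw I f F := (proj (T s), gamma (r s)).
pose c' s : grw I f F := if s < b then c s else ext s.
have c'_time s : s2 < s -> time_of c' s = T s.
  move=> s2s; rewrite /time_of /c'; case: ltP => sb.
    by rewrite Tt' ?s2s.
  by rewrite projE//; apply: IT; exact: lt_trans s2s.
have c'_fiber s : s2 < s -> fiber_of c' s = gamma (r s).
  move=> s2s; rewrite /fiber_of /c'; case: ltP => sb //.
  by rewrite gamma_q// s2s.
exists c'; split; last by move=> s [_]; rewrite lte_fin /c' => ->.
apply/geodesicP => //; split; first exact: lt_trans alpha_b (ltry _).
move=> s [as_ _]; case: (ltP s b) => sb.
  apply: (@geodesic_at_near_eq _ _ _ c).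
    near=> u; rewrite /c' ifT//; near: u; exact: lt_nbhsl.
  by apply: cGat; split; rewrite ?lte_fin.
have s2s : s2 < s by exact: lt_le_trans sb.
have s2N : \forall u \near s, s2 < u by exact: lt_nbhsr.
apply: (@grw_geodesic_at_lift _ _ _ I f F_riemannian f_diff f_gt0 c' T r gamma
  E K) => //.
- by apply: filterS s2N.
- by apply: filterS s2N.
- by apply: filterS s2N => u s2u; case: (TP u (lt_trans s02 s2u)).
- by apply: filterS s2N => u s2u; apply: rd; exact: lt_trans s2u.
- exact: gammaGat.
Unshelve. all: by end_near. Qed.
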